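(* Let $n\in\mathbb N$ and let $f(z)=\sum_{j\ge0}a_jz^j$ be extremal for $M_n$, normalized so that $a_0>0$ and $a_n>0$. Let $P(z)=a_n+2\sum_{j=1}^na_{n-j}z^j$. If $\mathrm{Re}\,P$ vanishes at $n$ distinct points $z_1,\dots,z_n\in\partial\mathbb D$, then \[f(z)\equiv a_0\prod_{j=1}^n(1-z_jz)^2 \pmod{z^{n+1}},\] $\prod_{j=1}^nz_j=(-1)^n$, and \[a_n=a_0\Big(2+\sum_{k=1}^{n-1}|e_k(z_1,\dots,z_n)|^2\Big),\] where $e_k$ is the $k$th elementary symmetric polynomial in $n$ variables.
   Context: $\mathbb D$ is the open unit disc; $\mathcal B_0=\{f$ holomorphic on $\mathbb D: 0<|f|\le1\}$; $M_n(f)=\mathrm{Re}\,a_n$; $f\in\mathcal B_0$ is extremal for $M_n$ if $M_n(f)\ge M_n(F)$ for all $F\in\mathcal B_0$. ''$F\equiv G \pmod{z^{n+1}}$'' means the Taylor coefficients of $F$ and $G$ at $0$ of orders $0,\dots,n$ agree. *)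

(* Defs.v *)
From HB Require Import structures.
From mathcomp Require Import all_boot all_order all_algebra.
From mathcomp Require Import all_classical all_reals all_analysis.
From mathcomp Require Import complex.
Import Order.TTheory GRing.Theory Num.Theory.
Import numFieldNormedType.Exports.
Set Implicit Arguments. Unset Strict Implicit. Unset Printing Implicit Defensive.
Local Open Scope ring_scope.

(* The complex plane over a real field R, viewed as a normed module over
   itself, so that [derivable f z 1] is complex differentiability. *)
Definition Cplx (R : realType) : Type := (R[i])^o.

Definition holo_disc (R : realType) (f : Cplx R -> Cplx R) : Prop :=
  forall z : Cplx R, `|z| < 1 -> derivable f z 1.

Definition B0 (R : realType) (f : Cplx R -> Cplx R) : Prop :=
  holo_disc f /\ forall z : Cplx R, `|z| < 1 -> 0 < `|f z| <= 1.

Definition tcoef (R : realType) (f : Cplx R -> Cplx R) (j : nat) : Cplx R :=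
  derive1n j f 0 / (j`!)%:R.

Definition Mn (R : realType) (n : nat) (f : Cplx R -> Cplx R) : R :=
  complex.Re (tcoef f n : R[i]).

Definition extremal (R : realType) (n : nat) (f : Cplx R -> Cplx R) : Prop :=
  B0 f /\ forall F : Cplx R -> Cplx R, B0 F -> Mn n F <= Mn n f.

Definition elem_sym (R : realType) (n k : nat) (zs : 'I_n -> Cplx R) : Cplx R :=
  \sum_(I : {set 'I_n} | #|I| == k) \prod_(i in I) zs i.

Definition Ppoly (R : realType) (n : nat) (f : Cplx R -> Cplx R) (z : Cplx R)
  : Cplx R :=
  tcoef f n + 2 * \sum_(1 <= j < n.+1) tcoef f (n - j) * z ^+ j.

(* Main.v *)
Require Import Defs.
From HB Require Import structures.
From mathcomp Require Import all_boot all_order all_algebra.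
From mathcomp Require Import all_classical all_reals all_analysis.
From mathcomp Require Import complex ring lra.
Import Order.TTheory GRing.Theory Num.Theory.
Import numFieldNormedType.Exports.
Local Open Scope ring_scope.
Set Implicit Arguments. Unset Strict Implicit. Unset Printing Implicit Defensive.

(* For |zeta| = 1 and h = (1 + zeta z) / (1 - zeta z), the function f / (1 + e h) lies in B0
   for every e > 0, and to first order in e its n-th coefficient is a_n - e P(zeta). Hence
   extremality gives Re P >= 0 on the unit circle. As z^n Re P is a polynomial of degree 2n
   on the circle, with leading coefficient a_0, each of the n given zeros is double, so it
   equals a_0 prod (z - z_j)^2; reading off coefficients gives the congruence. The middle
   coefficient is a_n = a_0 (-1)^n e_n sum_k |e_k|^2 because e_(n-k) = e_n conj(e_k), and
   a_n > 0 forces (-1)^n e_n = 1.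

   Holomorphy is assumed only as pointwise complex differentiability, so iterated
   derivatives need Goursat's theorem. In logarithmic coordinates around w it gives
   2 pi f'(w) as the integral of (f(w + s e^(it)) - f(w)) / (s e^(it)) over [0, 2 pi].
   For bounded f this bounds f', so f is Lipschitz; fed back into the formula, f' is
   Lipschitz, so f has a uniform second-order Taylor bound, which makes the difference
   quotients of f' converge. *)

(** * Complex derivatives in epsilon-delta form with a real-valued modulus *)

Section ComplexDifferentiability.
Local Open Scope classical_set_scope.
Variable R : realType.
Implicit Types (z w h d : R[i]) (f : R[i] -> R[i]).
Local Notation nm := (@Normc.normc R).

(** The norm on [R[i]] takes values in [R[i]], whose order is partial; through [nm] estimates become
    inequalities in [R], where [lra] applies. *)
Lemma normrE z : `|z| = (nm z)%:C%C.
Proof. by case: z. Qed.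

Lemma nm_ge0 z : 0 <= nm z.
Proof. by case: z => a b; apply: sqrtr_ge0. Qed.

Lemma nmD z w : nm (z + w) <= nm z + nm w.
Proof. exact: le_normcD. Qed.

Lemma nmN z : nm (- z) = nm z.
Proof. exact: normcN. Qed.

Lemma nmB z w : nm (z - w) = nm (w - z).
Proof. by rewrite -nmN opprB. Qed.

Lemma nmM z w : nm (z * w) = nm z * nm w.
Proof. exact: Normc.normcM. Qed.

Lemma nmV z : nm z^-1 = (nm z)^-1.
Proof. exact: Normc.normcV. Qed.

Lemma nm0 : nm 0 = 0.
Proof. exact: Normc.normc0. Qed.

Lemma nm1 : nm 1 = 1.
Proof. exact: Normc.normc1. Qed.

Lemma nmX z n : nm (z ^+ n) = nm z ^+ n.
Proof. by elim: n => [|n IH]; rewrite ?expr0 ?nm1// !exprS nmM IH. Qed.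

Lemma nm_eq0 z : (nm z == 0) = (z == 0).
Proof. by apply/eqP/eqP => [/Normc.eq0_normc//|->]; exact: nm0. Qed.

Lemma nm_real (x : R) : nm x%:C%C = `|x|.
Proof. by rewrite /= expr0n /= addr0 sqrtr_sqr. Qed.

Lemma Re_le_nm z : `|complex.Re z| <= nm z.
Proof. by rewrite -lecR -normrE; exact: normc_ge_Re. Qed.

Lemma Im_le_nm z : `|complex.Im z| <= nm z.
Proof. by case: z => a b /=; rewrite -sqrtr_sqr ler_wsqrtr// lerDr sqr_ge0. Qed.

Lemma nm_le_ReIm z : nm z <= `|complex.Re z| + `|complex.Im z|.
Proof.
case: z => a b; have -> : (a +i* b)%C = a%:C%C + 'i%C * b%:C%C by simpc.
apply: le_trans (nmD _ _) _; rewrite nmM !nm_real /=.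
by rewrite !(expr0n, expr1n, add0r, mulr0, mul0r, mul1r, addr0, subr0)/= sqrtr1 mul1r.
Qed.

Lemma ltr_norm1 z : (`|z| < 1) = (nm z < 1).
Proof. by rewrite normrE -[X in _ < X]/(1%:C%C) ltcR. Qed.

(** The inequality is multiplied out by [nm h], so [h = 0] needs no exclusion and no division enters
    the estimates. *)
Definition cdiff f z d := forall e : R, 0 < e -> exists2 r : R, 0 < r &
  forall h, nm h < r -> nm (f (z + h) - f z - d * h) <= e * nm h.

Lemma cdiffP f z d :
  cdiff f z d <-> derivable (f : Cplx R -> Cplx R) z 1 /\
                  derive1 (f : Cplx R -> Cplx R) z = d.
Proof.
have E : cdiff f z d <->
  (h^-1 *: ((f : Cplx R -> Cplx R) (h + z) - f z) @[h --> (0 : R[i]^o)^']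
     --> (d : Cplx R)).
  split=> [fd|].
    apply/cvgrPdist_lt => e e0.
    (* The epsilon of the limit is positive in [R[i]], hence real; half of it leaves room for the
       strict inequality. *)
    have [r r0 e2r] : exists2 r : R, 0 < r & r%:C%C < e.
      case: e e0 => a b; rewrite ltcE /= => /andP[/eqP -> a0].
      by exists (a / 2); rewrite ?divr_gt0// ltcR ltr_pdivrMr// ltr_pMr// ltr1n.
    have [s s0 H] := fd _ r0.
    near=> h; rewrite normrE; apply: le_lt_trans e2r; rewrite lecR.
    have h0 : h != 0 by near: h; exact: (@nbhs_dnbhs_neq (R[i])^o).
    have nh : 0 < nm h by rewrite lt_neqAle eq_sym nm_eq0 h0 nm_ge0.
    rewrite -(ler_pM2r nh) -nmM.
    rewrite mulrBl nmB [_ *: _]/(_ * _) mulrAC mulVf// mul1r [h + z]addrC.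
    apply: H; rewrite -ltcR -normrE.
    by near: h; apply: (@dnbhs0_lt _ (R[i])^o); rewrite ltcR.
  move=> /cvgrPdist_lt H e e0.
  have e0' : 0 < e%:C%C by rewrite ltcR.
  have := H _ e0'.
  rewrite near_withinE => /nbhs_ballP[r /=].
  move=> r0 Hr; move: r r0 Hr => [a b]; rewrite ltcE /= => /andP[/eqP ->{b} a0] Hr.
  exists a => // h ha; have [->|h0] := eqVneq h 0.
    by rewrite addr0 subrr mulr0 subrr nm0 mulr0.
  have nh : 0 < nm h by rewrite lt_neqAle eq_sym nm_eq0 h0 nm_ge0.
  have := Hr h; rewrite /ball /= sub0r normrN normrE ltcR => /(_ ha h0).
  rewrite normrE ltcR => /ltW; rewrite -(ler_pM2r nh) -nmM.
  by rewrite mulrBl nmB [_ *: _]/(_ * _) mulrAC mulVf// mul1r [h + z]addrC.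
rewrite E; split=> [H|[D <-]].
  split; last by rewrite /derive1; apply/cvg_lim.
  rewrite /derivable; apply/cvg_ex; exists d.
  rewrite (_ : (fun h => _) = (fun h => h^-1 *: ((f : Cplx R -> Cplx R) (h + z) - f z))) //.
  by apply/funext => h; rewrite [h *: 1]mulr1.
rewrite /derive1; move: D; rewrite /derivable.
rewrite (_ : (fun h => _) = (fun h => h^-1 *: ((f : Cplx R -> Cplx R) (h + z) - f z))) //.
by apply/funext => h; rewrite [h *: 1]mulr1.
Unshelve. all: by end_near. Qed.

End ComplexDifferentiability.

Arguments Normc.normc : simpl never.

(** * Bisection of intervals and rectangles *)

Section Bisection.
Variable R : realType.

Lemma nested_intervals (x w : nat -> R) :
  (forall k, x k <= x k.+1) -> (forall k, x k.+1 + w k.+1 <= x k + w k) ->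
  (forall k, 0 <= w k) -> exists p, forall k, x k <= p <= x k + w k.
Proof.
move=> xS wS w0.
have xm : {homo x : m n / (m <= n)%N >-> m <= n} by apply: homo_leq => //; apply: le_trans.
have wm : forall i j, (i <= j)%N -> x j + w j <= x i + w i.
  move=> i j; elim: j => [|j IH]; first by rewrite leqn0 => /eqP ->.
  by rewrite leq_eqVlt => /predU1P[->//|/IH]; exact: le_trans.
have ub k : ubound (range x) (x k + w k).
  move=> _ [m _ <-]; have [km|/ltnW mk] := leqP k m.
    by apply: le_trans (wm _ _ km); rewrite lerDl.
  by apply: le_trans (xm _ _ mk) _; rewrite lerDl.
exists (sup (range x)) => k; apply/andP; split.
  by apply: ub_le_sup; [exists (x 0%N + w 0%N) | exists k].
by apply: ge_sup; [exists (x 0%N), 0%N | ].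
Qed.

(** A compactness principle: [G x y k] speaks of the rectangle with corner [(x, y)] and sides
    [a / 2 ^+ k] and [b / 2 ^+ k]. If [G] failed at the start, it would fail on some quarter at
    every stage, and the local hypothesis at the common point of these nested rectangles gives a
    contradiction. With [b = 0] this is bisection of an interval. *)
Lemma bisection (a b x0 y0 : R) (G : R -> R -> nat -> Prop) :
  0 <= a -> 0 <= b ->
  let inside x y k := [/\ x0 <= x, x + a / 2 ^+ k <= x0 + a, y0 <= y &
                          y + b / 2 ^+ k <= y0 + b] in
  (forall x y k, inside x y k ->
     let u := a / 2 ^+ k.+1 in let v := b / 2 ^+ k.+1 in
     G x y k.+1 -> G (x + u) y k.+1 -> G x (y + v) k.+1 ->
     G (x + u) (y + v) k.+1 -> G x y k) ->
  (forall p q, x0 <= p <= x0 + a -> y0 <= q <= y0 + b -> exists K,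
     forall x y, inside x y K -> x <= p <= x + a / 2 ^+ K ->
       y <= q <= y + b / 2 ^+ K -> G x y K) ->
  G x0 y0 0%N.
Proof.
move=> a0 b0 inside GS Gloc; apply: contrapT => nG.
have half (c : R) k : c / 2 ^+ k = c / 2 ^+ k.+1 + c / 2 ^+ k.+1.
  by rewrite exprS; field; rewrite expf_neq0//= pnatr_eq0.
have w0 (c : R) k : 0 <= c -> 0 <= c / 2 ^+ k.
  by move=> c0; rewrite divr_ge0// exprn_ge0.
pose bad k (p : R * R) := inside p.1 p.2 k /\ ~ G p.1 p.2 k.
(* The implication sits inside the existential so that [choice] yields a total successor function,
   which is meaningful on bad rectangles only. *)
have step : forall kp : nat * (R * R), exists p' : R * R, bad kp.1 kp.2 ->
   [/\ bad kp.1.+1 p', kp.2.1 <= p'.1, kp.2.2 <= p'.2,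
       p'.1 + a / 2 ^+ kp.1.+1 <= kp.2.1 + a / 2 ^+ kp.1 &
       p'.2 + b / 2 ^+ kp.1.+1 <= kp.2.2 + b / 2 ^+ kp.1].
  move=> [k [x y]] /=.
  have [[ins nGk]|nb] := pselect (bad k (x, y)); last by exists (x, y).
  have ua := w0 _ k.+1 a0; have ub := w0 _ k.+1 b0.
  have ha := half a k; have hb := half b k.
  case: (ins) => /= i1 i2 i3 i4; rewrite /bad/=.
  have [n1|] := pselect (~ G x y k.+1).
    by exists (x, y) => _; split => //=; [split => //; split; lra | lra | lra].
  move=> /contrapT g1.
  have [n2|] := pselect (~ G (x + a / 2 ^+ k.+1) y k.+1).
    by exists (x + a / 2 ^+ k.+1, y) => _; split => //=; [split => //; split; lra | lra | lra | lra].
  move=> /contrapT g2.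
  have [n3|] := pselect (~ G x (y + b / 2 ^+ k.+1) k.+1).
    by exists (x, y + b / 2 ^+ k.+1) => _; split => //=; [split => //; split; lra | lra | lra | lra].
  move=> /contrapT g3.
  exists (x + a / 2 ^+ k.+1, y + b / 2 ^+ k.+1) => _; split => //=; try lra.
  split => [|g4]; first by split; lra.
  by apply: nGk; apply: GS.
have [nx nxP] := choice step.
pose s := fix s k := if k is k'.+1 then nx (k', s k') else (x0, y0).
have sbad k : bad k (s k).
  elim: k => [|k IH]; first by split => //=; rewrite /inside expr0 !divr1.
  by case: (nxP (k, s k) IH).
have [p pP] : exists p, forall k, (s k).1 <= p <= (s k).1 + a / 2 ^+ k.
  apply: nested_intervals => k; last exact: w0.
    by case: (nxP (k, s k) (sbad k)).
  by case: (nxP (k, s k) (sbad k)).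
have [q qP] : exists q, forall k, (s k).2 <= q <= (s k).2 + b / 2 ^+ k.
  apply: nested_intervals => k; last exact: w0.
    by case: (nxP (k, s k) (sbad k)).
  by case: (nxP (k, s k) (sbad k)).
have := pP 0%N; have := qP 0%N; rewrite /= expr0 !divr1 => q0 p0.
have [K GK] := Gloc p q p0 q0.
by have [ins] := sbad K; apply; apply: GK.
Qed.

Lemma exp2_small (a e : R) : 0 < e -> exists K : nat, a / 2 ^+ K < e.
Proof.
move=> e0; have [K aK] : exists K : nat, a / e < K%:R.
  exists (Num.bound `|a / e|); apply: le_lt_trans (ler_norm _) _.
  exact: archi_boundP.
exists K; rewrite ltr_pdivrMr ?exprn_gt0// mulrC -ltr_pdivrMr//.
by apply: lt_trans aK _; rewrite -natrX ltr_nat ltn_expl.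
Qed.

End Bisection.

(** * Integrals of complex-valued functions over real intervals *)

Section ComplexIntegral.
Variable R : realType.
Implicit Types (a b c x y M : R) (h : R -> R[i]).
Local Open Scope classical_set_scope.
Local Notation nm := (@Normc.normc R).
Local Notation mu := (@lebesgue_measure R).

Definition rcont h x := forall e : R, 0 < e -> exists2 d : R, 0 < d &
  forall y, `|y - x| < d -> nm (h y - h x) <= e.

Definition rcont_on a b h := forall x, a <= x <= b -> rcont h x.

Lemma rcontZD h1 h2 (k : R[i]) x : rcont h1 x -> rcont h2 x ->
  rcont (fun t => k * h1 t + h2 t) x.
Proof.
move=> c1 c2 e e0; have k0 : 0 < nm k + 1 by rewrite ltr_wpDl// nm_ge0.
have e2 : 0 < e / 2 by rewrite divr_gt0.
have [d1 d10 H1] := c1 (e / 2 / (nm k + 1)) (divr_gt0 e2 k0).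
have [d2 d20 H2] := c2 (e / 2) e2.
exists (Num.min d1 d2); first by rewrite lt_min d10.
move=> y; rewrite lt_min => /andP[/H1 n1 /H2 n2].
have -> : k * h1 y + h2 y - (k * h1 x + h2 x) = k * (h1 y - h1 x) + (h2 y - h2 x).
  by ring.
apply: le_trans (nmD _ _) _; rewrite nmM [e]splitr lerD//.
apply: (@le_trans _ _ ((nm k + 1) * (e / 2 / (nm k + 1)))).
  by apply: ler_pM; rewrite ?nm_ge0// lerDl.
by rewrite mulrC divfK// gt_eqF.
Qed.

Lemma rcont_part (p : R[i] -> R) h x :
  (forall z, `|p z| <= nm z) -> {morph p : z w / z - w >-> z - w} ->
  rcont h x -> {for x, continuous (p \o h)}.
Proof.
move=> pn pB ch; apply/cvgrPdist_le => /= e e0.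
have [d d0 H] := ch e e0; near=> y.
rewrite -pB; apply: le_trans (pn _) _; rewrite nmB; apply: H.
rewrite distrC; near: y; exact: cvgr_dist_lt.
Unshelve. all: by end_near. Qed.

Lemma rcont_Re h x : rcont h x -> {for x, continuous (@complex.Re R \o h)}.
Proof. by apply: rcont_part; [exact: Re_le_nm | move=> [? ?] [? ?]]. Qed.

Lemma rcont_Im h x : rcont h x -> {for x, continuous (@complex.Im R \o h)}.
Proof. by apply: rcont_part; [exact: Im_le_nm | move=> [? ?] [? ?]]. Qed.

Lemma itv_integrable a b (f : R -> R) :
  (forall x, a <= x <= b -> {for x, continuous f}) ->
  mu.-integrable `[a, b] (EFin \o f).
Proof.
move=> cf; apply: continuous_compact_integrable; first exact: segment_compact.
by apply: continuous_in_subspaceT => x; rewrite inE /= in_itv/= => /cf.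
Qed.

Definition cint h a b : R[i] :=
  (\int[mu]_(t in `[a, b]) complex.Re (h t) +i*
   \int[mu]_(t in `[a, b]) complex.Im (h t))%C.

Lemma cint_integrable a b h : rcont_on a b h ->
  mu.-integrable `[a, b] (EFin \o (@complex.Re R \o h)) /\
  mu.-integrable `[a, b] (EFin \o (@complex.Im R \o h)).
Proof.
move=> ch; split; apply: itv_integrable => x /ch.
  exact: rcont_Re.
exact: rcont_Im.
Qed.

Lemma Rint_cat a b c (f : R -> R) : a <= b <= c ->
  mu.-integrable `[a, c] (EFin \o f) ->
  \int[mu]_(t in `[a, c]) f t = \int[mu]_(t in `[a, b]) f t + \int[mu]_(t in `[b, c]) f t.
Proof.
move=> /andP[ab bc] fi.
have := @Rintegral_itvB R f (BLeft a) (BRight c) b fi.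
rewrite !bnd_simp ab bc => /(_ isT isT) E; apply/eqP; rewrite addrC -subr_eq; apply/eqP.
rewrite E Rintegral_itv_obnd_cbnd//; apply: integrableS fi => //.
by apply: subset_itvr; rewrite bnd_simp.
Qed.

Lemma cint_cat a b c h : a <= b <= c -> rcont_on a c h ->
  cint h a c = cint h a b + cint h b c.
Proof.
move=> abc /cint_integrable[ir ii].
by rewrite /cint (Rint_cat abc ir) (Rint_cat abc ii).
Qed.

Lemma cintZD a b h1 h2 (k : R[i]) : rcont_on a b h1 -> rcont_on a b h2 ->
  cint (fun t => k * h1 t + h2 t) a b = k * cint h1 a b + cint h2 a b.
Proof.
move=> /cint_integrable[ir1 ii1] /cint_integrable[ir2 ii2].
case: k => k1 k2; rewrite /cint.
have Z (f : R -> R) k : mu.-integrable `[a, b] (EFin \o f) ->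
    mu.-integrable `[a, b] (EFin \o (fun t => k * f t)).
  by move=> fi; exact: (@integrableZl _ _ _ mu _ (measurable_itv _) k _ fi).
have D (f g : R -> R) : mu.-integrable `[a, b] (EFin \o f) ->
    mu.-integrable `[a, b] (EFin \o g) ->
    mu.-integrable `[a, b] (EFin \o (fun t => f t + g t)).
  by move=> fi gi; exact: (@integrableD _ _ _ mu _ (measurable_itv _) _ _ fi gi).
have E1 : \int[mu]_(t in `[a, b]) complex.Re ((k1 +i* k2)%C * h1 t + h2 t) =
    k1 * \int[mu]_(t in `[a, b]) complex.Re (h1 t) +
    - k2 * \int[mu]_(t in `[a, b]) complex.Im (h1 t) +
    \int[mu]_(t in `[a, b]) complex.Re (h2 t).
  rewrite -!RintegralZl// -!RintegralD//; [|by apply: D; exact: Z|exact: Z|exact: Z].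
  by apply: eq_Rintegral => t _; case: (h1 t) => ? ?; case: (h2 t) => ? ? /=; ring.
have E2 : \int[mu]_(t in `[a, b]) complex.Im ((k1 +i* k2)%C * h1 t + h2 t) =
    k2 * \int[mu]_(t in `[a, b]) complex.Re (h1 t) +
    k1 * \int[mu]_(t in `[a, b]) complex.Im (h1 t) +
    \int[mu]_(t in `[a, b]) complex.Im (h2 t).
  rewrite -!RintegralZl// -!RintegralD//; [|by apply: D; exact: Z|exact: Z|exact: Z].
  by apply: eq_Rintegral => t _; case: (h1 t) => ? ?; case: (h2 t) => ? ? /=; ring.
rewrite E1 E2; simpc; congr Complex; ring.
Qed.

(** The fundamental theorem of calculus is applied for [a < b], so the one-point interval is treated
    apart. *)
Lemma Rint_affine a b (p q : R) : a <= b ->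
  \int[mu]_(t in `[a, b]) (p + q * t) = p * (b - a) + q * (b ^+ 2 - a ^+ 2) / 2.
Proof.
rewrite le_eqVlt => /predU1P[<-|ab].
  by rewrite set_itv1 Rintegral_set1 !subrr !(mulr0, mul0r) addr0.
pose P (t : R) := p * t + q / 2 * t ^+ 2.
have dP x : is_derive x 1 P (p + q * x).
  rewrite /P; apply: is_derive_eq.
  by rewrite /GRing.scale /= ; field.
have cP : continuous P.
  by move=> x; apply: differentiable_continuous; apply/derivable1_diffP; case: (dP x).
have E := @continuous_FTC2 R (fun t => p + q * t) P a b ab.
rewrite /Rintegral E.
- by rewrite /P /=; field.
- apply: continuous_subspaceT => x; apply: cvgD; first exact: cvg_cst.
  by apply: cvgM; [exact: cvg_cst|exact: cvg_id].
- split=> [x _||]; first by case: (dP x).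
    by apply: cvg_at_right_filter; exact: cP.
  by apply: cvg_at_left_filter; exact: cP.
- by move=> x _; rewrite derive1E; apply/derive_val.
Qed.

Lemma Rint_le a b (f : R -> R) M : a <= b ->
  mu.-integrable `[a, b] (EFin \o f) -> (forall x, a <= x <= b -> `|f x| <= M) ->
  `|\int[mu]_(t in `[a, b]) f t| <= M * (b - a).
Proof.
move=> ab fi fM; apply: le_trans (@le_normr_Rintegral _ _ _ mu _ _ (measurable_itv _) fi) _.
have -> : M * (b - a) = \int[mu]_(t in `[a, b]) (M + 0 * t).
  by rewrite Rint_affine//; ring.
apply: (@le_Rintegral _ _ _ mu _ _ _ (measurable_itv _)).
- exact: (integrable_norm fi).
- apply: itv_integrable => x _; apply: cvgD; first exact: cvg_cst.
  by apply: cvgM; [exact: cvg_cst|exact: cvg_id].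
- by move=> x /=; rewrite in_itv/= mul0r addr0; exact: fM.
Qed.

(** The factor 2 comes from bounding the real and imaginary integrals separately; it propagates into
    the constants below. *)
Lemma cint_le a b h M : a <= b -> rcont_on a b h ->
  (forall x, a <= x <= b -> nm (h x) <= M) -> nm (cint h a b) <= 2 * M * (b - a).
Proof.
move=> ab /cint_integrable[ir ii] hM; apply: le_trans (nm_le_ReIm _) _ => /=.
have -> : 2 * M * (b - a) = M * (b - a) + M * (b - a) by ring.
apply: lerD; apply: Rint_le => // x /hM; apply: le_trans.
  exact: Re_le_nm.
exact: Im_le_nm.
Qed.

Lemma cint_affine a b (p q : R[i]) : a <= b ->
  cint (fun t => p + q * t%:C%C) a b =
  p * (b - a)%:C%C + q * ((b ^+ 2 - a ^+ 2) / 2)%:C%C.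
Proof.
move=> ab; case: p q => [p1 p2] [q1 q2]; rewrite /cint.
have -> : \int[mu]_(t in `[a, b]) complex.Re ((p1 +i* p2)%C + (q1 +i* q2)%C * t%:C%C) =
    \int[mu]_(t in `[a, b]) (p1 + q1 * t).
  by apply: eq_Rintegral => t _ /=; ring.
have -> : \int[mu]_(t in `[a, b]) complex.Im ((p1 +i* p2)%C + (q1 +i* q2)%C * t%:C%C) =
    \int[mu]_(t in `[a, b]) (p2 + q2 * t).
  by apply: eq_Rintegral => t _ /=; ring.
by rewrite !Rint_affine//; simpc; congr Complex; ring.
Qed.

End ComplexIntegral.

(** * Goursat's theorem on rectangles *)

Section Goursat.
Variable R : realType.
Implicit Types (x y : R) (z : R[i]) (H : R[i] -> R[i]).
Local Notation nm := (@Normc.normc R).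

Definition ccont H z := forall e : R, 0 < e -> exists2 d : R, 0 < d &
  forall h, nm h < d -> nm (H (z + h) - H z) <= e.

Lemma cdiff_cont H z d : cdiff H z d -> ccont H z.
Proof.
move=> Hd e e0; have [r r0 Hr] := Hd 1 ltr01.
have k0 : 0 < 1 + nm d by rewrite ltr_pwDl// nm_ge0.
exists (Num.min r (e / (1 + nm d))); first by rewrite lt_min r0 divr_gt0.
move=> h; rewrite lt_min => /andP[/Hr h1 h2].
have -> : H (z + h) - H z = (H (z + h) - H z - d * h) + d * h by ring.
apply: le_trans (nmD _ _) _; rewrite nmM.
apply: (@le_trans _ _ ((1 + nm d) * nm h)); first by rewrite mulrDl lerD.
by rewrite mulrC -ler_pdivlMr//; exact: ltW.
Qed.

Lemma ccontZD H1 H2 k z : ccont H1 z -> ccont H2 z ->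
  ccont (fun z => k * H1 z + H2 z) z.
Proof.
move=> c1 c2 e e0; have k0 : 0 < nm k + 1 by rewrite ltr_wpDl// nm_ge0.
have e2 : 0 < e / 2 by rewrite divr_gt0.
have [d1 d10 h1] := c1 (e / 2 / (nm k + 1)) (divr_gt0 e2 k0).
have [d2 d20 h2] := c2 (e / 2) e2.
exists (Num.min d1 d2); first by rewrite lt_min d10.
move=> h; rewrite lt_min => /andP[/h1 n1 /h2 n2].
have -> : k * H1 (z + h) + H2 (z + h) - (k * H1 z + H2 z) =
  k * (H1 (z + h) - H1 z) + (H2 (z + h) - H2 z) by ring.
apply: le_trans (nmD _ _) _; rewrite nmM [e]splitr lerD//.
apply: (@le_trans _ _ ((nm k + 1) * (e / 2 / (nm k + 1)))).
  by apply: ler_pM; rewrite ?nm_ge0// lerDl.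
by rewrite mulrC divfK// gt_eqF.
Qed.

Lemma ccont_affine p q z : ccont (fun z => p + q * z) z.
Proof.
have k0 : 0 < 1 + nm q by rewrite ltr_pwDl// nm_ge0.
move=> e e0; exists (e / (1 + nm q)); first by rewrite divr_gt0.
move=> h h1; have -> : p + q * (z + h) - (p + q * z) = q * h by ring.
rewrite nmM; apply: (@le_trans _ _ ((1 + nm q) * nm h)).
  by rewrite ler_wpM2r ?nm_ge0// lerDr.
by rewrite mulrC -ler_pdivlMr//; exact: ltW.
Qed.

Lemma ccont_horiz H x y : ccont H (x +i* y)%C -> rcont (fun t => H (t +i* y)%C) x.
Proof.
move=> c e /c[d d0 Hd]; exists d => // t td.
have -> : (t +i* y)%C = (x +i* y)%C + (t - x)%:C%C by simpc; congr Complex; ring.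
by apply: Hd; rewrite nm_real.
Qed.

Lemma nm_i : nm 'i%C = 1.
Proof. by rewrite /Normc.normc expr0n/= expr1n add0r sqrtr1. Qed.

Lemma ccont_vert H x y : ccont H (x +i* y)%C -> rcont (fun t => H (x +i* t)%C) y.
Proof.
move=> c e /c[d d0 Hd]; exists d => // t td.
have -> : (x +i* t)%C = (x +i* y)%C + 'i%C * (t - y)%:C%C by simpc; congr Complex; ring.
by apply: Hd; rewrite nmM nm_i mul1r nm_real.
Qed.

Definition ccont_rect H x1 x2 y1 y2 := forall x y, x1 <= x <= x2 ->
  y1 <= y <= y2 -> ccont H (x +i* y)%C.

(** The contour integral of [H] around the rectangle, counterclockwise from the lower left corner;
    on the vertical sides [dz = i dt]. *)
Definition rect_int H x1 x2 y1 y2 : R[i] :=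
  cint (fun t => H (t +i* y1)%C) x1 x2 + 'i%C * cint (fun t => H (x2 +i* t)%C) y1 y2
  - cint (fun t => H (t +i* y2)%C) x1 x2 - 'i%C * cint (fun t => H (x1 +i* t)%C) y1 y2.

Lemma rect_horiz H x1 x2 y1 y2 y : ccont_rect H x1 x2 y1 y2 -> y1 <= y <= y2 ->
  rcont_on x1 x2 (fun t => H (t +i* y)%C).
Proof. by move=> c yy x xx; apply: ccont_horiz; apply: c. Qed.

Lemma rect_vert H x1 x2 y1 y2 x : ccont_rect H x1 x2 y1 y2 -> x1 <= x <= x2 ->
  rcont_on y1 y2 (fun t => H (x +i* t)%C).
Proof. by move=> c xx y yy; apply: ccont_vert; apply: c. Qed.

Lemma rect_int_catx H x1 m x2 y1 y2 : x1 <= m <= x2 -> y1 <= y2 ->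
  ccont_rect H x1 x2 y1 y2 ->
  rect_int H x1 x2 y1 y2 = rect_int H x1 m y1 y2 + rect_int H m x2 y1 y2.
Proof.
move=> xm yy c; rewrite /rect_int.
rewrite (cint_cat xm (rect_horiz c (y := y1) _)) ?lexx//.
rewrite (cint_cat xm (rect_horiz c (y := y2) _)) ?lexx ?andbT//; ring.
Qed.

Lemma rect_int_caty H x1 x2 y1 m y2 : y1 <= m <= y2 -> x1 <= x2 ->
  ccont_rect H x1 x2 y1 y2 ->
  rect_int H x1 x2 y1 y2 = rect_int H x1 x2 y1 m + rect_int H x1 x2 m y2.
Proof.
move=> ym xx c; rewrite /rect_int.
rewrite (cint_cat ym (rect_vert c (x := x1) _)) ?lexx//.
rewrite (cint_cat ym (rect_vert c (x := x2) _)) ?lexx ?andbT//; ring.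
Qed.

Lemma rect_intZD H1 H2 k x1 x2 y1 y2 : x1 <= x2 -> y1 <= y2 ->
  ccont_rect H1 x1 x2 y1 y2 -> ccont_rect H2 x1 x2 y1 y2 ->
  rect_int (fun z => k * H1 z + H2 z) x1 x2 y1 y2 =
  k * rect_int H1 x1 x2 y1 y2 + rect_int H2 x1 x2 y1 y2.
Proof.
move=> xx yy c1 c2; rewrite /rect_int.
rewrite (cintZD _ (rect_horiz c1 (y := y1) _) (rect_horiz c2 (y := y1) _)) ?lexx//.
rewrite (cintZD _ (rect_horiz c1 (y := y2) _) (rect_horiz c2 (y := y2) _)) ?lexx ?andbT//.
rewrite (cintZD _ (rect_vert c1 (x := x1) _) (rect_vert c2 (x := x1) _)) ?lexx//.
rewrite (cintZD _ (rect_vert c1 (x := x2) _) (rect_vert c2 (x := x2) _)) ?lexx ?andbT//.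
ring.
Qed.

Lemma rect_int_affine p q x1 x2 y1 y2 : x1 <= x2 -> y1 <= y2 ->
  rect_int (fun z => p + q * z) x1 x2 y1 y2 = 0.
Proof.
move=> xx yy; rewrite /rect_int.
have hE y : (fun t => p + q * (t +i* y)%C) =
    (fun t : R => (p + q * ('i%C * y%:C%C)) + q * t%:C%C).
  apply/funext => t; have -> : (t +i* y)%C = t%:C%C + 'i%C * y%:C%C by simpc.
  ring.
have vE x : (fun t => p + q * (x +i* t)%C) =
    (fun t : R => (p + q * x%:C%C) + (q * 'i%C) * t%:C%C).
  apply/funext => t; have -> : (x +i* t)%C = x%:C%C + 'i%C * t%:C%C by simpc.
  ring.
rewrite !hE !vE !cint_affine// {hE vE}.
by case: p q => [p1 p2] [q1 q2]; simpc; congr Complex; field.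
Qed.

(** Two sides in each direction, each with the factor 2 of [cint_le], make the 4. *)
Lemma rect_int_le H x1 x2 y1 y2 M : x1 <= x2 -> y1 <= y2 ->
  ccont_rect H x1 x2 y1 y2 ->
  (forall x y, x1 <= x <= x2 -> y1 <= y <= y2 -> nm (H (x +i* y)%C) <= M) ->
  nm (rect_int H x1 x2 y1 y2) <= 4 * M * ((x2 - x1) + (y2 - y1)).
Proof.
move=> xx yy c HM.
have b1 : nm (cint (fun t => H (t +i* y1)%C) x1 x2) <= 2 * M * (x2 - x1).
  by apply: cint_le => // [|x ?]; [apply: rect_horiz c _ | apply: HM]; rewrite ?lexx.
have b2 : nm (cint (fun t => H (t +i* y2)%C) x1 x2) <= 2 * M * (x2 - x1).
  by apply: cint_le => // [|x ?]; [apply: rect_horiz c _ | apply: HM]; rewrite ?lexx ?andbT.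
have b3 : nm (cint (fun t => H (x1 +i* t)%C) y1 y2) <= 2 * M * (y2 - y1).
  by apply: cint_le => // [|y ?]; [apply: rect_vert c _ | apply: HM]; rewrite ?lexx.
have b4 : nm (cint (fun t => H (x2 +i* t)%C) y1 y2) <= 2 * M * (y2 - y1).
  by apply: cint_le => // [|y ?]; [apply: rect_vert c _ | apply: HM]; rewrite ?lexx ?andbT.
rewrite /rect_int.
apply: le_trans (nmD _ _) _; rewrite nmN nmM nm_i mul1r.
have := nmD (cint (fun t => H (t +i* y1)%C) x1 x2 + 'i%C * cint (fun t => H (x2 +i* t)%C) y1 y2)
  (- cint (fun t => H (t +i* y2)%C) x1 x2).
have := nmD (cint (fun t => H (t +i* y1)%C) x1 x2) ('i%C * cint (fun t => H (x2 +i* t)%C) y1 y2).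
rewrite nmN nmM nm_i mul1r; lra.
Qed.

Lemma rect_int_quarter H x y u v : 0 <= u -> 0 <= v ->
  ccont_rect H x (x + u + u) y (y + v + v) ->
  rect_int H x (x + u + u) y (y + v + v) =
  rect_int H x (x + u) y (y + v) + rect_int H x (x + u) (y + v) (y + v + v) +
  (rect_int H (x + u) (x + u + u) y (y + v) +
   rect_int H (x + u) (x + u + u) (y + v) (y + v + v)).
Proof.
move=> u0 v0 c.
have xu : x <= x + u by rewrite lerDl.
have xuu : x + u <= x + u + u by rewrite lerDl.
have yv : y <= y + v by rewrite lerDl.
have yvv : y + v <= y + v + v by rewrite lerDl.
rewrite (@rect_int_catx H x (x + u)) ?xu//; last exact: le_trans yv yvv.
rewrite (@rect_int_caty H x (x + u) y (y + v)) ?yv//; last first.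
  by move=> s t /andP[? st]; apply: c; apply/andP; split => //; exact: le_trans st xuu.
rewrite (@rect_int_caty H (x + u) (x + u + u) y (y + v)) ?yv//.
by move=> s t /andP[xs ?]; apply: c; apply/andP; split => //; exact: le_trans xu xs.
Qed.

(** Bisection on the claim that a rectangle of level [k] has integral at most [c / 4 ^+ k]. The
    bounds for four quarters add up; near a point, the affine part of [H] integrates to 0, and the
    rest is a small multiple of the side lengths, integrated over a perimeter of the same order. *)
Lemma Goursat H dH x1 x2 y1 y2 : x1 <= x2 -> y1 <= y2 ->
  (forall x y, x1 <= x <= x2 -> y1 <= y <= y2 -> cdiff H (x +i* y)%C (dH (x +i* y)%C)) ->
  rect_int H x1 x2 y1 y2 = 0.
Proof.
move=> xx yy Hd; apply/eqP; rewrite -nm_eq0 eq_le nm_ge0 andbT.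
apply/ler_addgt0Pr => /= c c0; rewrite add0r.
pose a := x2 - x1; pose b := y2 - y1.
have a0 : 0 <= a by rewrite subr_ge0.
have b0 : 0 <= b by rewrite subr_ge0.
have cH : ccont_rect H x1 x2 y1 y2 by move=> x y ? ?; apply: cdiff_cont; apply: Hd.
have cS x1' x2' y1' y2' : x1 <= x1' -> x2' <= x2 -> y1 <= y1' -> y2' <= y2 ->
    ccont_rect H x1' x2' y1' y2'.
  by move=> ? ? ? ? x y /andP[? ?] /andP[? ?]; apply: cH; apply/andP; split; lra.
have := @bisection R a b x1 y1 (fun x y k =>
  nm (rect_int H x (x + a / 2 ^+ k) y (y + b / 2 ^+ k)) <= c / 4 ^+ k) a0 b0.
(* At level 0 the rectangle is the given one, since [x1 + (x2 - x1) = x2]. *)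
rewrite /= !expr0 !divr1 /a /b -/a -/b !(addrC _ a) !(addrC _ b) /a /b !subrK.
apply; rewrite -/a -/b.
  move=> x y k [i1 i2 i3 i4].
  have u0 : 0 <= a / 2 ^+ k.+1 by rewrite divr_ge0// exprn_ge0.
  have v0 : 0 <= b / 2 ^+ k.+1 by rewrite divr_ge0// exprn_ge0.
  have half (r : R) : r / 2 ^+ k = r / 2 ^+ k.+1 + r / 2 ^+ k.+1.
    by rewrite exprS; field; rewrite expf_neq0//= pnatr_eq0.
  have -> : c / 4 ^+ k = c / 4 ^+ k.+1 + c / 4 ^+ k.+1 + (c / 4 ^+ k.+1 + c / 4 ^+ k.+1).
    by rewrite exprS; field; rewrite expf_neq0//= pnatr_eq0.
  move: i2 i4; rewrite !half !addrA.
  move: (a / _) (b / _) u0 v0 => u v u0 v0; rewrite /a /b => i2 i4 g1 g2 g3 g4.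
  rewrite rect_int_quarter//; last by apply: cS => //; rewrite ?lerDl.
  rewrite -addrA; apply: le_trans (nmD _ _) _; apply: lerD.
    by apply: le_trans (nmD _ _) _; exact: lerD.
  by apply: le_trans (nmD _ _) _; exact: lerD.
move=> p q pp qq.
have pp' : x1 <= p <= x2 by rewrite /a in pp; lra.
have qq' : y1 <= q <= y2 by rewrite /b in qq; lra.
pose z0 := (p +i* q)%C.
have D0 : 0 < 4 * (a + b) ^+ 2 + 1 by rewrite ltr_wpDl// mulr_ge0// sqr_ge0.
(* Chosen so that [4 * e * (a + b) ^+ 2 <= c]; the added 1 keeps the denominator positive when
   [a + b = 0]. *)
pose e := c / (4 * (a + b) ^+ 2 + 1).
have e0 : 0 < e by rewrite divr_gt0.
have [r r0 Hr] := Hd p q pp' qq' e e0.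
have [K HK] := exp2_small (a + b) r0.
exists K => x y [i1 i2 i3 i4] px qy.
set u := a / 2 ^+ K in i2 px *; set v := b / 2 ^+ K in i4 qy *.
have u0 : 0 <= u by rewrite divr_ge0// exprn_ge0.
have v0 : 0 <= v by rewrite divr_ge0// exprn_ge0.
have uvr : u + v < r by rewrite /u /v -mulrDl.
(* The affine approximation of [H] at [z0], then the remainder [H - L] in the shape that
   [rect_intZD] accepts. *)
pose L := fun z => (H z0 - dH z0 * z0) + dH z0 * z.
pose r1 := fun z => (-1) * L z + H z.
have cL : ccont_rect L x (x + u) y (y + v) by move=> *; exact: ccont_affine.
have cH' : ccont_rect H x (x + u) y (y + v) by apply: cS.
have -> : rect_int H x (x + u) y (y + v) = rect_int r1 x (x + u) y (y + v).
  by rewrite rect_intZD ?lerDl// rect_int_affine ?lerDl// mulr0 add0r.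
have cr : ccont_rect r1 x (x + u) y (y + v).
  by move=> s t ss tt; apply: ccontZD; [exact: cL | exact: cH'].
have b1 : nm (rect_int r1 x (x + u) y (y + v)) <= 4 * (e * (u + v)) * (u + v).
  have -> : 4 * (e * (u + v)) * (u + v) = 4 * (e * (u + v)) * ((x + u - x) + (y + v - y)).
    by ring.
  apply: rect_int_le => //; rewrite ?lerDl// => s t ss tt.
  have hle : nm ((s +i* t)%C - z0) <= u + v.
    apply: le_trans (nm_le_ReIm _) _; rewrite /z0; simpc.
    by rewrite /=; apply: lerD; rewrite ler_norml; lra.
  have -> : r1 (s +i* t)%C = H (z0 + ((s +i* t)%C - z0)) - H z0 - dH z0 * ((s +i* t)%C - z0).
    by rewrite /r1 /L [z0 + _]addrC subrK; ring.
  apply: le_trans (Hr _ _) _; first exact: le_lt_trans hle _.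
  by rewrite ler_wpM2l// ltW.
apply: le_trans b1 _.
have -> : 4 * (e * (u + v)) * (u + v) = c * (4 * (a + b) ^+ 2 / (4 * (a + b) ^+ 2 + 1)) / 4 ^+ K.
  have -> : 4 ^+ K = 2 ^+ K * 2 ^+ K :> R by rewrite -exprMn; congr (_ ^+ _); ring.
  rewrite /e /u /v; field; rewrite expf_neq0 ?pnatr_eq0//=; exact: lt0r_neq0.
rewrite ler_wpM2r ?invr_ge0 ?exprn_ge0//.
by rewrite ger_pMr// ler_pdivrMr// mul1r lerDl.
Qed.

End Goursat.

(** * The complex exponential and a mean value formula for the derivative *)

Section CauchyMean.
Variable R : realType.
Implicit Types (x y u : R) (z w : R[i]) (f : R[i] -> R[i]).
Local Notation nm := (@Normc.normc R).
Local Notation derivable f z := (derivable (f : Cplx R -> Cplx R) z 1).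
Local Notation derive1 f := (derive1 (f : Cplx R -> Cplx R)).

Lemma is_derive_approx (g : R -> R) x d : is_derive x 1 g d ->
  forall e : R, 0 < e -> exists2 r : R, 0 < r &
    forall t, `|t| < r -> `|g (x + t) - g x - d * t| <= e * `|t|.
Proof.
move=> [gx <-] e e0; move: gx; rewrite /derive.
move=> /cvgrPdist_le /(_ e e0); rewrite near_withinE => /nbhs_ballP[r /= r0 Hr].
exists r => // t tr; have [->|t0] := eqVneq t 0.
  by rewrite addr0 subrr mulr0 subrr !normr0 mulr0.
have nt : 0 < `|t| by rewrite normr_gt0.
have := Hr t; rewrite /ball /= sub0r normrN => /(_ tr t0).
rewrite -(ler_pM2r nt) -normrM mulrBl distrC [t *: 1]mulr1 [t + x]addrC.
by rewrite [_ *: _]/(_ * _) mulrAC mulVf// mul1r.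
Qed.

Definition cexp z : R[i] :=
  (expR (complex.Re z) * cos (complex.Im z) +i* (expR (complex.Re z) * sin (complex.Im z)))%C.

Lemma cexpD z w : cexp (z + w) = cexp z * cexp w.
Proof.
case: z w => [a b] [c d]; rewrite /cexp /= expRD cosD sinD; simpc.
by congr Complex; ring.
Qed.

Lemma cexp0 : cexp 0 = 1.
Proof. by rewrite /cexp /= expR0 cos0 sin0 mulr1 mulr0. Qed.

Lemma cexpN z : cexp (- z) = (cexp z)^-1.
Proof.
have E : cexp z * cexp (- z) = 1 by rewrite -cexpD subrr cexp0.
have z0 : cexp z != 0 by apply: contra_eq_neq E => ->; rewrite mul0r eq_sym oner_eq0.
by apply: (mulfI z0); rewrite E mulfV.
Qed.

Lemma nm_cexp z : nm (cexp z) = expR (complex.Re z).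
Proof.
rewrite /cexp /Normc.normc !exprMn -mulrDr cos2Dsin2 mulr1 sqrtr_sqr.
by rewrite ger0_norm// expR_ge0.
Qed.

Lemma cexp_2pi x : cexp (x +i* (2 * pi))%C = cexp (x +i* 0)%C.
Proof. by rewrite /cexp /= !mulr_natl cos2pi sin2pi cos0 sin0. Qed.

(** First-order expansions of [expR], [cos] and [sin] at 0 give the derivative at 0; [cexpD] carries
    it to any [z]. *)
Lemma cdiff_cexp z : cdiff cexp z (cexp z).
Proof.
have H0 : cdiff cexp 0 1.
  move=> e e0.
  (* The 9 is the total of the errors [c1] to [c4] below, which are [3 + 3 + 2 + 1] times
     [d * N]. *)
  have [d [d0 d1 d9]] : exists d : R, [/\ 0 < d, d <= 1 & 9 * d <= e].
    exists (Num.min (e / 9) 1); rewrite lt_min divr_gt0//= ge_min lexx orbT.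
    by split => //; rewrite mulrC -ler_pdivlMr// ge_min lexx.
  have [r1 r10 H1] := is_derive_approx (is_derive_expR 0) d0.
  have [r2 r20 H2] := is_derive_approx (is_derive_cos 0) d0.
  have [r3 r30 H3] := is_derive_approx (is_derive_sin 0) d0.
  exists (Num.min (Num.min r1 r2) (Num.min r3 d)); first by rewrite !lt_min r10 r20 r30 d0.
  move=> [a b]; rewrite !lt_min => /andP[/andP[n1 n2] /andP[n3 n4]].
  have ha := Re_le_nm (a +i* b)%C; have hb := Im_le_nm (a +i* b)%C.
  rewrite /= in ha hb.
  have := H1 a (le_lt_trans ha n1); have := H2 b (le_lt_trans hb n2).
  have := H3 b (le_lt_trans hb n3).
  rewrite !add0r expR0 cos0 sin0 oppr0 mul0r !mul1r !subr0 !addr0.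
  set N := nm _ in ha hb n4 *.
  move=> h3 h2 h1; rewrite cexp0.
  have -> : cexp (a +i* b)%C - 1 - (a +i* b)%C =
     ((expR a * cos b - 1 - a) +i* (expR a * sin b - b))%C.
    by rewrite /cexp /=; simpc; congr Complex; rewrite ?subr0.
  apply: le_trans (nm_le_ReIm _) _; rewrite /=.
  have E1 : expR a * cos b - 1 - a = expR a * (cos b - 1) + (expR a - 1 - a) by ring.
  have E2 : expR a * sin b - b = expR a * (sin b - b) + (expR a - 1) * b by ring.
  have N0 : 0 <= N by exact: nm_ge0.
  have a2 : `|expR a - 1| <= 2 * `|a|.
    have -> : expR a - 1 = (expR a - 1 - a) + a by ring.
    apply: le_trans (ler_normD _ _) _; have := ler_piMl (normr_ge0 a) d1; lra.
  have a3 : `|expR a| <= 3.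
    have -> : expR a = (expR a - 1) + 1 by ring.
    apply: le_trans (ler_normD _ _) _; rewrite normr1; lra.
  have c1 : `|expR a * (cos b - 1)| <= 3 * (d * N).
    rewrite normrM; apply: ler_pM => //; apply: le_trans h2 _.
    by rewrite ler_wpM2l// ltW.
  have c2 : `|expR a * (sin b - b)| <= 3 * (d * N).
    rewrite normrM; apply: ler_pM => //; apply: le_trans h3 _.
    by rewrite ler_wpM2l// ltW.
  have c3 : `|(expR a - 1) * b| <= (2 * d) * N.
    rewrite normrM; apply: ler_pM => //; apply: le_trans a2 _; lra.
  have c4 : `|expR a - 1 - a| <= d * N by apply: le_trans h1 _; rewrite ler_wpM2l// ltW.
  rewrite E1 E2.
  have := ler_normD (expR a * (cos b - 1)) (expR a - 1 - a).
  have := ler_normD (expR a * (sin b - b)) ((expR a - 1) * b).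
  have := ler_wpM2r N0 d9; lra.
move=> e e0; have k0 : 0 < nm (cexp z) by rewrite nm_cexp expR_gt0.
have [r r0 Hr] := H0 (e / nm (cexp z)) (divr_gt0 e0 k0).
exists r => // h /Hr; rewrite add0r cexp0 cexpD mul1r => Hh.
have -> : cexp z * cexp h - cexp z - cexp z * h = cexp z * (cexp h - 1 - h) by ring.
rewrite nmM mulrC; apply: le_trans (ler_wpM2r (nm_ge0 _) Hh) _.
by rewrite mulrAC divfK// gt_eqF.
Qed.

Lemma derivable_cexp z : derivable cexp z.
Proof. by have /cdiffP[] := cdiff_cexp z. Qed.

Lemma derivable_ccomp f g z : derivable g z -> derivable f (g z) ->
  derivable (f \o g) z.
Proof.
move=> /derivable1_diffP gz /derivable1_diffP fz; apply/derivable1_diffP.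
exact: (differentiable_comp gz fz).
Qed.

Lemma derivable_cdiff f z : derivable f z -> cdiff f z (derive1 f z).
Proof. by move=> fz; apply/cdiffP. Qed.

(* Put z = w + e^(x + i t). By Goursat the integral over 0 <= t <= 2 pi does not depend
   on x, since the sides t = 0 and t = 2 pi cancel; let x -> -oo. *)
Lemma cint_circle f w u : (forall z, nm (z - w) <= expR u -> derivable f z) ->
  cint (fun t => (f (w + cexp (u +i* t)%C) - f w) * cexp (- (u +i* t)%C)) 0 (2 * pi)
  = derive1 f w * (2 * pi)%:C%C.
Proof.
move=> df; pose H := fun z => (f (w + cexp z) - f w) * cexp (- z).
have pi2 : 0 <= 2 * pi :> R by rewrite mulr_ge0// pi_ge0.
have dH z : complex.Re z <= u -> derivable H z.
  move=> zu; apply: derivableM.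
    apply: derivableB; last exact: derivable_cst.
    apply: (@derivable_ccomp f (fun z => w + cexp z)).
      by apply: derivableD; [exact: derivable_cst | exact: derivable_cexp].
    by apply: df; rewrite addrC addKr nm_cexp ler_expR.
  apply: (@derivable_ccomp cexp (fun z => - z)); last exact: derivable_cexp.
  by apply: derivableN; exact: derivable_id.
have rH x : x <= u -> rcont_on 0 (2 * pi) (fun t => H (x +i* t)%C).
  move=> xu t _; apply: ccont_vert; apply: cdiff_cont; apply: derivable_cdiff.
  exact: dH.
have Hcst x : x <= u -> cint (fun t => H (x +i* t)%C) 0 (2 * pi) =
    cint (fun t => H (u +i* t)%C) 0 (2 * pi).
  move=> xu; have := @Goursat R H (derive1 H) x u 0 (2 * pi) xu pi2.
  move=> G; have {G} : rect_int H x u 0 (2 * pi) = 0.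
    by apply: G => s t /andP[_ su] _; apply: derivable_cdiff; apply: dH.
  rewrite /rect_int.
  have -> : (fun t => H (t +i* (2 * pi))%C) = (fun t => H (t +i* 0)%C).
    by apply/funext => t; rewrite /H !cexpN cexp_2pi.
  set A := cint _ x u; set B := cint _ 0 _; set C := cint _ 0 _.
  move=> E.
  have i0 : 'i%C != 0 :> R[i] by rewrite eq_complex /= oner_eq0 andbF.
  apply: (mulfI i0); apply/eqP; rewrite eq_sym -subr_eq0; apply/eqP; rewrite -[RHS]E.
  clearbody A B C; ring.
have fw : cdiff f w (derive1 f w).
  by apply: derivable_cdiff; apply: df; rewrite subrr nm0 expR_ge0.
apply/eqP; rewrite -subr_eq0 -nm_eq0 eq_le nm_ge0 andbT.
apply/ler_addgt0Pr => /= e e0; rewrite add0r.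
have P0 : 0 < 2 * (2 * pi) :> R by rewrite !mulr_gt0// pi_gt0.
(* The denominator compensates the factor 2 of [cint_le] and the length [2 * pi] of the interval. *)
have [r r0 Hr] := fw (e / (2 * (2 * pi))) (divr_gt0 e0 P0).
pose x := Num.min u (ln (r / 2)).
have xu : x <= u by rewrite ge_min lexx.
have xr : expR x < r.
  apply: (@le_lt_trans _ _ (r / 2)); last by rewrite ltr_pdivrMr// ltr_pMr// ltr1n.
  rewrite -[leRHS]lnK ?posrE ?divr_gt0// ler_expR.
  by rewrite ge_min lexx orbT.
rewrite -(Hcst x xu).
have cc : rcont_on 0 (2 * pi) (fun=> derive1 f w).
  by move=> s _ e' e'0; exists 1 => // y _; rewrite subrr nm0 ltW.
have -> : derive1 f w * (2 * pi)%:C%C = cint (fun=> derive1 f w) 0 (2 * pi).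
  have := cint_affine (derive1 f w) 0 pi2; rewrite mul0r addr0 subr0 => <-.
  by congr cint; apply/funext => t; rewrite mul0r addr0.
have -> : cint (fun t => H (x +i* t)%C) 0 (2 * pi) - cint (fun=> derive1 f w) 0 (2 * pi) =
    cint (fun t => (-1) * derive1 f w + H (x +i* t)%C) 0 (2 * pi).
  by rewrite cintZD//; [ring | exact: rH].
apply: le_trans (_ : 2 * (e / (2 * (2 * pi))) * (2 * pi - 0) <= e).
  apply: cint_le => //; first by move=> s ss; apply: rcontZD; [exact: cc | exact: rH].
  move=> t _; pose h := cexp (x +i* t)%C.
  have nh : nm h = expR x by rewrite nm_cexp.
  have h0 : h != 0 by rewrite -nm_eq0 nh gt_eqF// expR_gt0.
  have -> : -1 * derive1 f w + H (x +i* t)%C = (f (w + h) - f w - derive1 f w * h) / h.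
    by rewrite /H cexpN -/h; field.
  rewrite nmM nmV ler_pdivrMr ?nh ?expR_gt0// -nh; apply: Hr.
  by rewrite nh.
have p0 : pi != 0 :> R by apply: lt0r_neq0; exact: pi_gt0.
by rewrite subr0 le_eqVlt; apply/orP; left; apply/eqP; move: pi p0 => p p0; field.
Qed.

End CauchyMean.

(** * Complex differentiability of the derivative *)

Section HolomorphicDerivative.
Variable R : realType.
Implicit Types (x y u s M : R) (z w h : R[i]) (f : R[i] -> R[i]).
Local Notation nm := (@Normc.normc R).
Local Notation derivable f z := (derivable (f : Cplx R -> Cplx R) z 1).
Local Notation derive1 f := (derive1 (f : Cplx R -> Cplx R)).

(** Bisection of [[0, 1]] with slack [e] added to [M]. On a short subinterval containing [p], the
    values at both endpoints are compared with the value at [p]; up to the factor [nm h], the errors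
    [e * (x + u - p)] and [e * (p - x)] add up to [e * u]. *)
Lemma mean_value_ineq f df z h M :
  (forall t : R, 0 <= t <= 1 -> cdiff f (z + t%:C%C * h) (df (z + t%:C%C * h)) /\
     nm (df (z + t%:C%C * h)) <= M) ->
  nm (f (z + h) - f z) <= M * nm h.
Proof.
move=> Hf; have [->|h0] := eqVneq h 0.
  by rewrite addr0 subrr nm0 mulr0.
have nh : 0 < nm h by rewrite lt_neqAle eq_sym nm_eq0 h0 nm_ge0.
rewrite -ler_pdivrMr//; apply/ler_addgt0Pr => /= e e0; rewrite ler_pdivrMr//.
have z01 : 0 <= 1 :> R by [].
pose G x (y : R) k := nm (f (z + (x + 1 / 2 ^+ k)%:C%C * h) -
  f (z + x%:C%C * h)) <= (M + e) * (1 / 2 ^+ k) * nm h.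
suff : G 0 0 0%N.
  by rewrite /G expr0 divr1 add0r mul1r mul0r addr0 mulr1.
apply: (@bisection R 1 0 0 0 G z01 (lexx 0)).
  move=> x y k _ u; move=> v; rewrite {}/G -/u => G1 G2 _ _.
  have -> : 1 / 2 ^+ k = u + u :> R.
    by rewrite /u exprS; field; rewrite expf_neq0//= pnatr_eq0.
  rewrite addrA.
  have := nmD (f (z + (x + u + u)%:C%C * h) - f (z + (x + u)%:C%C * h))
              (f (z + (x + u)%:C%C * h) - f (z + x%:C%C * h)).
  by rewrite addrA subrK; lra.
move=> p q1 p01 _; rewrite add0r in p01; have [fp dM] := Hf p p01.
have [r r0 Hr] := fp e e0.
have [K HK] := exp2_small (nm h) r0.
exists K => x y _; rewrite {}/G; set u := 1 / 2 ^+ K => px _.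
have u0 : 0 <= u by rewrite divr_ge0// exprn_ge0.
have uh : u * nm h < r by rewrite /u mulrAC mul1r.
set zp := z + p%:C%C * h in fp dM Hr *.
have loc q : `|q - p| <= u ->
    nm (f (z + q%:C%C * h) - f zp - df zp * ((q - p)%:C%C * h)) <= e * (`|q - p| * nm h).
  move=> qp; have -> : z + q%:C%C * h = zp + (q - p)%:C%C * h.
    by rewrite /zp rmorphB/=; ring.
  rewrite -nm_real -nmM; apply: Hr; rewrite nmM nm_real.
  by apply: le_lt_trans uh; rewrite ler_wpM2r ?nm_ge0.
have l1 : nm _ <= _ := loc (x + u) _.
have l2 : nm _ <= _ := loc x _.
have a1 : `|x + u - p| = x + u - p by rewrite ger0_norm//; lra.
have a2 : `|x - p| = p - x by rewrite distrC ger0_norm//; lra.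
rewrite a1 in l1; rewrite a2 in l2.
have {}l1 := l1 ltac:(lra); have {}l2 := l2 ltac:(lra).
have -> : f (z + (x + u)%:C%C * h) - f (z + x%:C%C * h) =
   (f (z + (x + u)%:C%C * h) - f zp - df zp * ((x + u - p)%:C%C * h)) +
   (df zp * (u%:C%C * h) - (f (z + x%:C%C * h) - f zp - df zp * ((x - p)%:C%C * h))).
  by rewrite !rmorphB/= !rmorphD/=; ring.
apply: le_trans (nmD _ _) _.
have := nmD (df zp * (u%:C%C * h)) (- (f (z + x%:C%C * h) - f zp - df zp * ((x - p)%:C%C * h))).
have d1 : nm (df zp * (u%:C%C * h)) <= M * (u * nm h).
  rewrite !nmM nm_real (ger0_norm u0) ler_wpM2r//.
  by rewrite mulr_ge0// nm_ge0.
have -> : (M + e) * u * nm h = e * ((x + u - p) * nm h) + (M * (u * nm h) + e * ((p - x) * nm h)) by ring.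
by rewrite nmN; lra.
Qed.

Lemma rcontM (k1 k2 : R -> R[i]) x : rcont k1 x -> rcont k2 x ->
  rcont (fun t => k1 t * k2 t) x.
Proof.
move=> c1 c2 e e0; pose D := 1 + nm (k1 x) + nm (k2 x).
have D0 : 0 < D by rewrite /D; have := nm_ge0 (k1 x); have := nm_ge0 (k2 x); lra.
have [d [d0 d1 dD]] : exists d : R, [/\ 0 < d, d <= 1 & d * D <= e].
  exists (Num.min (e / D) 1); rewrite lt_min divr_gt0//= ge_min lexx orbT.
  by split => //; rewrite -ler_pdivlMr// ge_min lexx.
have [r1 r10 H1] := c1 d d0; have [r2 r20 H2] := c2 d d0.
exists (Num.min r1 r2); first by rewrite lt_min r10.
move=> y; rewrite lt_min => /andP[/H1 n1 /H2 n2].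
have -> : k1 y * k2 y - k1 x * k2 x = (k1 y - k1 x) * (k2 y - k2 x) +
  ((k1 y - k1 x) * k2 x + k1 x * (k2 y - k2 x)) by ring.
apply: le_trans (nmD _ _) _.
have := nmD ((k1 y - k1 x) * k2 x) (k1 x * (k2 y - k2 x)).
have m1 := ler_pM (nm_ge0 _) (nm_ge0 _) n1 (le_trans n2 d1).
have m2 := ler_wpM2r (nm_ge0 (k2 x)) n1; have m3 := ler_wpM2l (nm_ge0 (k1 x)) n2.
move: dD; rewrite /D !nmM; lra.
Qed.

Section Radius.
Variables (f : R[i] -> R[i]) (s M : R).
Hypotheses (s0 : 0 < s) (df : forall z, nm z < 4 * s -> derivable f z)
  (fM : forall z, nm z < 4 * s -> nm (f z) <= M).

(** The circle of radius [s] in the coordinates of [cint_circle], with [u = ln s]. Each average over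
    it costs one [s] of radius: [f] is bounded up to [4 * s], its derivative is bounded up to
    [3 * s], Lipschitz up to [2 * s] and differentiable up to [s]. *)
Let circ (t : R) := cexp (ln s +i* t)%C.

Let nm_circ t : nm (circ t) = s.
Proof. by rewrite nm_cexp lnK. Qed.

Let quot (g : R[i] -> R[i]) w t := (g (w + circ t) - g w) / circ t.

Let M0 : 0 <= M.
Proof. by apply: le_trans (fM (z := 0) _); rewrite ?nm_ge0// nm0 mulr_gt0. Qed.

Let C0 : 0 <= 16 * M / s ^+ 2.
Proof. by rewrite divr_ge0 ?mulr_ge0 ?exprn_ge0 ?(ltW s0). Qed.

Let circ_lt w t r : nm w < r -> nm (w + circ t) < r + s.
Proof. by move=> wr; apply: le_lt_trans (nmD _ _) _; rewrite nm_circ ltrD2r. Qed.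

Let disc_lt w z r : nm w < r -> nm (z - w) <= s -> nm z < r + s.
Proof.
by move=> wr zw; rewrite -(subrK w z) addrC; apply: le_lt_trans (nmD _ _) _; lra.
Qed.

Let rcont_quot g w : (forall z, nm (z - w) <= s -> ccont g z) ->
  rcont_on 0 (2 * pi) (quot g w).
Proof.
move=> cg x _; apply: rcontM.
  have cx : ccont g (w + circ x) by apply: cg; rewrite addrC addKr nm_circ.
  move=> e e0; have [d d0 Hd] := cx e e0.
  have cc : rcont circ x by apply: ccont_vert; exact: cdiff_cont (cdiff_cexp _).
  have d20 : 0 < d / 2 by rewrite divr_gt0.
  have [r r0 Hr] := cc (d / 2) d20.
  exists r => // y /Hr yx.
  have -> : g (w + circ y) - g w - (g (w + circ x) - g w) =
    g (w + circ x + (circ y - circ x)) - g (w + circ x).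
    have -> : w + circ x + (circ y - circ x) = w + circ y by ring.
    by ring.
  by apply: Hd; apply: le_lt_trans yx _; rewrite ltr_pdivrMr// ltr_pMr// ltr1n.
have -> : (fun t => (circ t)^-1) = (fun t => cexp (- (ln s +i* t)%C)).
  by apply/funext => t; rewrite cexpN.
have dN z : derivable (fun z => cexp (- z)) z.
  apply: (@derivable_ccomp R (@cexp R) (fun z => - z)); last exact: derivable_cexp.
  by apply: derivableN; exact: derivable_id.
apply: (@ccont_vert _ (fun z => cexp (- z))); apply: cdiff_cont.
exact: (derivable_cdiff (dN _)).
Qed.

Let df_cont w : nm w < 3 * s -> forall z, nm (z - w) <= s -> ccont f z.
Proof.
have s_gt0 := s0.
move=> ws z zw; apply: cdiff_cont; apply: derivable_cdiff; apply: df.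
by have := disc_lt ws zw; lra.
Qed.

Let mean_deriv w : nm w < 3 * s ->
  derive1 f w * (2 * pi)%:C%C = cint (quot f w) 0 (2 * pi).
Proof.
have s_gt0 := s0.
move=> ws; rewrite -(@cint_circle _ f w (ln s)).
  by congr cint; apply/funext => t; rewrite cexpN.
by move=> z; rewrite lnK// => /(disc_lt ws) zw; apply: df; lra.
Qed.

(** The common estimate for numbers given by circle averages; the 2 is that of [cint_le]. *)
Let mean_le k w B : rcont_on 0 (2 * pi) k ->
  w * (2 * pi)%:C%C = cint k 0 (2 * pi) -> (forall t, nm (k t) <= B / s) ->
  nm w <= 2 * B / s.
Proof.
have s_gt0 := s0.
have p0 : 0 < 2 * pi :> R by rewrite mulr_gt0// pi_gt0.
move=> ck E kB; rewrite -(ler_pM2r p0).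
have <- : nm (w * (2 * pi)%:C%C) = nm w * (2 * pi).
  by rewrite nmM nm_real ger0_norm// ltW.
have -> : 2 * B / s * (2 * pi) = 2 * (B / s) * (2 * pi - 0) by ring.
by rewrite E; apply: cint_le => //; exact: ltW.
Qed.

(** Cauchy's estimate: the numerator of the difference quotient is at most [2 * M]. *)
Let derive_bound w : nm w < 3 * s -> nm (derive1 f w) <= 4 * M / s.
Proof.
have s_gt0 := s0.
move=> ws; have -> : 4 * M / s = 2 * (2 * M) / s by ring.
apply: (mean_le (rcont_quot (df_cont ws)) (mean_deriv ws)) => t.
rewrite /quot nmM nmV nm_circ ler_pM2r ?invr_gt0//.
apply: le_trans (nmD _ _) _; rewrite nmN.
have w4 : nm w < 4 * s by lra.
have wc4 : nm (w + circ t) < 4 * s by have := circ_lt t ws; lra.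
by have := fM w4; have := fM wc4; lra.
Qed.

Let segment_lt z h r (t : R) : nm z < r -> nm (z + h) < r -> 0 <= t <= 1 ->
  nm (z + t%:C%C * h) < r.
Proof.
have s_gt0 := s0.
move=> zr zhr /andP[t0 t1].
have -> : z + t%:C%C * h = (1 - t)%:C%C * z + t%:C%C * (z + h).
  by rewrite rmorphB/=; ring.
apply: (@le_lt_trans _ _ (Num.max (nm z) (nm (z + h)))); last by rewrite gt_max zr.
apply: le_trans (nmD _ _) _; rewrite !nmM !nm_real !ger0_norm ?subr_ge0//.
have -> : Num.max (nm z) (nm (z + h)) =
  (1 - t) * Num.max (nm z) (nm (z + h)) + t * Num.max (nm z) (nm (z + h)) by ring.
by apply: lerD; apply: ler_wpM2l; rewrite ?subr_ge0// le_max lexx ?orbT.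
Qed.

Let lipschitz z h : nm z < 3 * s -> nm (z + h) < 3 * s ->
  nm (f (z + h) - f z) <= 4 * M / s * nm h.
Proof.
have s_gt0 := s0.
move=> zs zhs; apply: (@mean_value_ineq f (derive1 f)) => t t01.
have lt := segment_lt zs zhs t01.
split; last exact: derive_bound.
by apply: derivable_cdiff; apply: df; lra.
Qed.

(** Subtracting the mean formulas at [w] and [w + h] and regrouping leaves the increments of [f] by
    [h] at [w + circ t] and at [w], both controlled by [lipschitz]. *)
Let derive_lipschitz w h : nm w < 2 * s -> nm (w + h) < 2 * s ->
  nm (derive1 f (w + h) - derive1 f w) <= 16 * M / s ^+ 2 * nm h.
Proof.
have s_gt0 := s0.
move=> ws whs.
have ws3 : nm w < 3 * s by lra.
have whs3 : nm (w + h) < 3 * s by lra.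
have c1 := rcont_quot (df_cont ws3); have c2 := rcont_quot (df_cont whs3).
have -> : 16 * M / s ^+ 2 * nm h = 2 * (2 * (4 * M / s * nm h)) / s.
  by field; exact: lt0r_neq0.
apply: (@mean_le (fun t => (-1) * quot f w t + quot f (w + h) t)).
- by move=> x xx; apply: rcontZD; [exact: c1 | exact: c2].
- rewrite (cintZD _ c1 c2) -(mean_deriv ws3) -(mean_deriv whs3).
  by move: (derive1 f w) (derive1 f (w + h)) (_%:C%C) => A B P; ring.
move=> t.
have -> : -1 * quot f w t + quot f (w + h) t =
   ((f (w + circ t + h) - f (w + circ t)) - (f (w + h) - f w)) / circ t.
  rewrite /quot (addrAC w h); move: (circ t)^-1 (f (w + circ t + h)) (f (w + circ t)).
  by move: (f (w + h)) (f w) => ? ? ? ? ?; ring.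
rewrite nmM nmV nm_circ ler_pM2r ?invr_gt0//.
apply: le_trans (nmD _ _) _; rewrite nmN.
have wk : nm w < 3 * s by lra.
have whk : nm (w + h) < 3 * s by lra.
have wck : nm (w + circ t) < 3 * s by have := circ_lt t ws; lra.
have wchk : nm (w + circ t + h) < 3 * s by rewrite addrAC; have := circ_lt t whs; lra.
have := lipschitz wk whk; have := lipschitz wck wchk.
lra.
Qed.

(** The mean value inequality for [g w = f w - d * w], whose derivative on the segment is small by
    [derive_lipschitz]. *)
Let taylor1 z h : nm z < 2 * s -> nm (z + h) < 2 * s ->
  nm (f (z + h) - f z - derive1 f z * h) <= 16 * M / s ^+ 2 * nm h ^+ 2.
Proof.
have s_gt0 := s0.
move=> zs zhs; pose d := derive1 f z.
have -> : f (z + h) - f z - d * h = (f (z + h) - d * (z + h)) - (f z - d * z) by ring.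
rewrite [nm h ^+ 2]expr2 mulrA; pose g w := f w - d * w.
suff gP : forall t : R, 0 <= t <= 1 ->
    cdiff g (z + t%:C%C * h) (derive1 f (z + t%:C%C * h) - d) /\
    nm (derive1 f (z + t%:C%C * h) - d) <= 16 * M / s ^+ 2 * nm h.
  exact: (@mean_value_ineq g (fun w => derive1 f w - d) z h _ gP).
move=> t t01; have lt := segment_lt zs zhs t01; split.
  have fc : cdiff f (z + t%:C%C * h) (derive1 f (z + t%:C%C * h)).
    by apply: derivable_cdiff; apply: df; lra.
  move=> e e0; have [r r0 Hr] := fc e e0; exists r => // h' /Hr.
  by rewrite /g; congr (nm _ <= _); ring.
apply: le_trans (derive_lipschitz zs lt) _.
case/andP: t01 => t0 t1.
apply: ler_wpM2l; first exact: C0.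
by rewrite nmM nm_real ger0_norm// ler_piMl// nm_ge0.
Qed.

(** The mean formula is differentiated under the integral: the error is the average of a difference
    of two remainders as in [taylor1], divided by [circ t], hence of order [nm h ^+ 2]. *)
Lemma derivable_derive1 w : nm w < s ->
  derivable (derive1 f) w /\ nm (derive1 f w) <= 4 * M / s.
Proof.
have s_gt0 := s0.
move=> ws; split; last by apply: derive_bound; lra.
have p0 : (2 * pi)%:C%C != 0 :> R[i].
  by rewrite -nm_eq0 nm_real normr_eq0 mulf_neq0//; apply: lt0r_neq0; exact: pi_gt0.
have := C0; set C := 16 * M / s ^+ 2 => C_ge0.
have cdf z : nm (z - w) <= s -> ccont (derive1 f) z.
  move=> /(disc_lt ws) zs e e0.
  have C1 : 0 < C + 1 by lra.
  exists (Num.min (2 * s - nm z) (e / (C + 1))); first by rewrite lt_min divr_gt0// andbT; lra.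
  move=> h; rewrite lt_min => /andP[h1 h2].
  apply: le_trans (derive_lipschitz _ _) _; [lra| |].
    by apply: le_lt_trans (nmD _ _) _; lra.
  move: h2; rewrite ltr_pdivlMr// -/C; have := nm_ge0 h; lra.
(* The expected second derivative: the mean formula with [derive1 f] in place of [f]. *)
pose D := cint (quot (derive1 f) w) 0 (2 * pi) / (2 * pi)%:C%C.
suff : cdiff (derive1 f) w D by case/cdiffP.
move=> e e0; have E0 : 0 < 2 * (2 * C) / s + 1.
  by rewrite ltr_wpDl// divr_ge0 ?(ltW s0)// mulr_ge0// mulr_ge0.
exists (Num.min (s - nm w) (e / (2 * (2 * C) / s + 1))).
  by rewrite lt_min divr_gt0// andbT; lra.
move=> h; rewrite lt_min => /andP[h1 h2].
have whs : nm (w + h) < s by apply: le_lt_trans (nmD _ _) _; lra.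
have ws3 : nm w < 3 * s by lra.
have whs3 : nm (w + h) < 3 * s by lra.
have c1 := rcont_quot (df_cont ws3); have c2 := rcont_quot (df_cont whs3).
have c3 := rcont_quot cdf.
have c4 : rcont_on 0 (2 * pi) (fun t => (-1) * quot f w t + quot f (w + h) t).
  by move=> x xx; apply: rcontZD; [exact: c1 | exact: c2].
apply: (@le_trans _ _ (2 * (2 * (C * nm h ^+ 2)) / s)); last first.
  move: h2; rewrite ltr_pdivlMr// => h2.
  have -> : 2 * (2 * (C * nm h ^+ 2)) / s = nm h * (2 * (2 * C) / s) * nm h by ring.
  by rewrite ler_wpM2r ?nm_ge0//; have := nm_ge0 h; lra.
apply: (@mean_le (fun t => (- h) * quot (derive1 f) w t +
  ((-1) * quot f w t + quot f (w + h) t))).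
- by move=> x xx; apply: rcontZD; [exact: c3 | exact: c4].
- rewrite (cintZD _ c3 c4) (cintZD _ c1 c2) -(mean_deriv ws3) -(mean_deriv whs3) /D.
  move: (derive1 f w) (derive1 f (w + h)) (cint _ _ _) (_%:C%C) p0 => A B I P P0.
  by field.
move=> t.
have -> : - h * quot (derive1 f) w t + (-1 * quot f w t + quot f (w + h) t) =
   ((f (w + circ t + h) - f (w + circ t) - derive1 f (w + circ t) * h) -
    (f (w + h) - f w - derive1 f w * h)) / circ t.
  rewrite /quot (addrAC w h); move: (circ t)^-1 (f (w + circ t + h)) (f (w + circ t)).
  move: (derive1 f (w + circ t)) (derive1 f w) (f (w + h)) (f w) => ? ? ? ? ? ? ?.
  by ring.
rewrite nmM nmV nm_circ ler_pM2r ?invr_gt0//.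
apply: le_trans (nmD _ _) _; rewrite nmN.
have wk : nm w < 2 * s by lra.
have whk : nm (w + h) < 2 * s by lra.
have wck : nm (w + circ t) < 2 * s by have := circ_lt t ws; lra.
have wchk : nm (w + circ t + h) < 2 * s by rewrite addrAC; have := circ_lt t whs; lra.
apply: le_trans (lerD (taylor1 wck wchk) (taylor1 wk whk)) _.
by rewrite [leRHS]mulr_natl mulr2n.
Qed.

End Radius.

Lemma derivable_derive1n f r M : 0 < r ->
  (forall z, nm z < r -> derivable f z) -> (forall z, nm z < r -> nm (f z) <= M) ->
  forall k, exists2 r' : R, 0 < r' & forall z, nm z < r' -> derivable (derive1n k (f : Cplx R -> Cplx R)) z.
Proof.
move=> r0 df fM k.
(* A bound joins the induction because [derivable_derive1] consumes one and returns one, on a disc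
   of a quarter of the radius. *)
suff [r' [M' [r'0 H]]] : exists r' M', 0 < r' /\ forall z, nm z < r' ->
    derivable (derive1n k (f : Cplx R -> Cplx R)) z /\
    nm (derive1n k (f : Cplx R -> Cplx R) z) <= M'.
  by exists r' => // z /H[].
elim: k => [|k [s [N [s0 H]]]]; first by exists r, M; split=> // z zr; split; [exact: df | exact: fM].
exists (s / 4), (4 * N / (s / 4)); split=> [|z zs]; first by rewrite divr_gt0.
have E : 4 * (s / 4) = s by field.
apply: derivable_derive1 => // [|y|y]; rewrite ?divr_gt0// E => /H[] //.
Qed.

End HolomorphicDerivative.

(** * Taylor coefficients of the perturbed function and nonnegativity of [Re P] on the circle *)

Section Variation.
Variable R : realType.
Implicit Types (f g u v : R[i] -> R[i]).
Local Notation nm := (@Normc.normc R).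
Local Notation derivable f z := (derivable (f : Cplx R -> Cplx R) z 1).
Local Notation derive1 f := (derive1 (f : Cplx R -> Cplx R)).
Local Notation derive1n k f := (derive1n k (f : Cplx R -> Cplx R)).
Local Notation tcoef f k := (tcoef (f : Cplx R -> Cplx R) k : R[i]).

Lemma cdiff_eq_ball f g r : (forall z, nm z < r -> f z = g z) ->
  forall z d, nm z < r -> cdiff g z d -> cdiff f z d.
Proof.
move=> fg z d zr gd e e0; have [s s0 Hs] := gd e e0.
exists (Num.min s (r - nm z)); first by rewrite lt_min s0 subr_gt0.
move=> h; rewrite lt_min => /andP[hs hr]; rewrite !fg//; first exact: Hs.
by apply: le_lt_trans (nmD _ _) _; lra.
Qed.

Lemma cdiff_derive1 f z d : cdiff f z d -> derive1 f z = d.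
Proof. by case/cdiffP. Qed.

(** The combination has the shape of the right-hand side in [derive1n_linear_factor], whose
    induction step is then one application. *)
Lemma cdiff_linear_factor (a b c : R[i]) u v z du dv : cdiff u z du -> cdiff v z dv ->
  cdiff (fun z => (b - a * z) * u z - c * v z) z
    (- a * u z + (b - a * z) * du - c * dv).
Proof.
move=> Du Dv e e0; pose N := 1 + nm (b - a * z) + nm a + nm c.
have N0 : 0 < N.
  by rewrite /N; have := nm_ge0 (b - a * z); have := nm_ge0 a; have := nm_ge0 c; lra.
have [q [d0 qN]] : exists q, 0 < q /\ q * N <= e.
  by exists (e / N); rewrite divr_gt0// divfK// gt_eqF.
have [r1 r10 H1] := Du _ d0; have [r2 r20 H2] := Dv _ d0.
have [r3 r30 H3] := cdiff_cont Du d0.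
exists (Num.min r1 (Num.min r2 r3)); first by rewrite !lt_min r10 r20.
move=> h; rewrite !lt_min => /and3P[/H1 n1 /H2 n2 /H3 n3].
set E1 := u (z + h) - u z - du * h in n1; set E2 := v (z + h) - v z - dv * h in n2.
set E3 := u (z + h) - u z in n3.
have -> : (b - a * (z + h)) * u (z + h) - c * v (z + h) - ((b - a * z) * u z - c * v z)
    - (- a * u z + (b - a * z) * du - c * dv) * h =
  (b - a * z) * E1 + (- (a * (h * E3)) - c * E2).
  by rewrite /E1 /E2 /E3; ring.
apply: le_trans (nmD _ _) _; apply: (@le_trans _ _ (q * N * nm h)); last first.
  by rewrite ler_wpM2r ?nm_ge0.
have := nmD (- (a * (h * E3))) (- (c * E2)); rewrite !nmN !nmM.
have m1 := ler_wpM2l (nm_ge0 (b - a * z)) n1; have m2 := ler_wpM2l (nm_ge0 c) n2.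
have m3 := ler_wpM2l (nm_ge0 a) (ler_wpM2l (nm_ge0 h) n3).
have m4 : 0 <= q * nm h by rewrite mulr_ge0 ?nm_ge0// ltW.
move: m1 m2 m3 m4; rewrite /N; move: (nm (b - a * z)) (nm a) (nm c) (nm h).
move=> x y t k m1 m2 m3 m4 m5; lra.
Qed.

(** The radius may shrink with [k]: only derivatives at 0 enter [tcoef], but differentiating them
    again takes a disc. *)
Definition smooth0 f := forall k, exists2 r : R, 0 < r &
  forall z, nm z < r -> derivable (derive1n k f) z.

(** Leibniz' rule keeps two terms because the second derivative of the linear factor vanishes. The
    identity is proved on a disc so that it can be differentiated again. *)
Lemma derive1n_linear_factor (a b : R[i]) f : smooth0 f -> forall k,
  exists2 r : R, 0 < r & forall z, nm z < r ->
    derive1n k.+1 (fun z => (b - a * z) * f z) z =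
    (b - a * z) * derive1n k.+1 f z - (k.+1%:R * a) * derive1n k f z.
Proof.
move=> sf; elim=> [|k [r r0 Hr]].
  have [r r0 Hr] := sf 0%N; exists r => // z /Hr fz.
  have E := cdiff_derive1 (cdiff_linear_factor a b 0 (derivable_cdiff fz) (derivable_cdiff fz)).
  have EF : (fun z => (b - a * z) * f z - 0 * f z) = (fun z => (b - a * z) * f z).
    by apply/funext => w; rewrite mul0r subr0.
  rewrite EF in E; rewrite -[LHS]/(derive1 (fun z => (b - a * z) * f z) z) E.
  rewrite -[derive1n 1 f z]/(derive1 f z) -[derive1n 0 f z]/(f z).
  by move: (derive1 f z) (f z) => A B; ring.
have [r1 r10 H1] := sf k; have [r2 r20 H2] := sf k.+1.
exists (Num.min r (Num.min r1 r2)); first by rewrite !lt_min r0 r10.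
move=> z; rewrite !lt_min => /and3P[zr z1 z2].
have E := cdiff_linear_factor a b (k.+1%:R * a) (derivable_cdiff (H2 z z2)) (derivable_cdiff (H1 z z1)).
rewrite -[LHS]/(derive1 (derive1n k.+1 (fun z => (b - a * z) * f z)) z).
have zr' : nm z < r by [].
rewrite (cdiff_derive1 (cdiff_eq_ball Hr zr' E)).
rewrite -[derive1 (derive1n k.+1 f) z]/(derive1n k.+2 f z).
rewrite -[derive1 (derive1n k f) z]/(derive1n k.+1 f z).
move: (derive1n k.+2 f z) (derive1n k.+1 f z) => A B.
by rewrite -[k.+2]addn1 natrD; ring.
Qed.

Lemma derive1_eq_ball f g r : (forall z, nm z < r -> f z = g z) ->
  forall z, nm z < r -> derive1 f z = derive1 g z.
Proof.
move=> fg z zr; rewrite !derive1E; apply: near_eq_derive.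
apply/nbhs_ballP; exists (r - nm z)%:C%C; first by rewrite /= ltcR subr_gt0.
move=> w; rewrite /ball /= normrE ltcR => zw; apply: fg.
by rewrite -(subrK z w) addrC; apply: le_lt_trans (nmD _ _) _; move: zw; rewrite nmB; lra.
Qed.

Lemma tcoef_eq_ball f g r : 0 < r -> (forall z, nm z < r -> f z = g z) ->
  forall k, tcoef f k = tcoef g k.
Proof.
move=> r0 fg k; rewrite /Defs.tcoef; congr (_ / _).
suff H : forall z, nm z < r -> derive1n k f z = derive1n k g z by apply: H; rewrite nm0.
by elim: k => [//|k IH] z zr; exact: (derive1_eq_ball IH zr).
Qed.

Lemma tcoef_linear_factor0 (a b : R[i]) f :
  tcoef (fun z => (b - a * z) * f z) 0 = b * tcoef f 0.
Proof. by rewrite /Defs.tcoef /= mulr0 subr0 mulrA. Qed.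

Lemma tcoef_linear_factorS (a b : R[i]) f k : smooth0 f ->
  tcoef (fun z => (b - a * z) * f z) k.+1 = b * tcoef f k.+1 - a * tcoef f k.
Proof.
move=> sf; have [r r0 H] := derive1n_linear_factor a b sf k.
have E : derive1n k.+1 (fun z => (b - a * z) * f z) 0 =
    b * derive1n k.+1 f 0 - k.+1%:R * a * derive1n k f 0.
  by rewrite [LHS]H ?nm0// mulr0 subr0.
have k0 : k.+1%:R != 0 :> R[i] by rewrite pnatr_eq0.
have f0 : (k`!)%:R != 0 :> R[i] by rewrite pnatr_eq0 -lt0n fact_gt0.
have -> : tcoef (fun z => (b - a * z) * f z) k.+1 =
  derive1n k.+1 (fun z => (b - a * z) * f z) 0 / (k.+1`!)%:R by [].
rewrite {}E /Defs.tcoef factS natrM.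
move: (derive1n k.+1 f 0) (derive1n k f 0) => A B; move: k.+1 k0 (k`!) f0 => n n0 m m0.
by field; rewrite n0 m0.
Qed.

Lemma unit_normrE (z : R[i]) : (0 < `|z| <= 1) = (0 < nm z <= 1).
Proof.
by rewrite normrE -[X in X < _]/(0%:C%C) -[X in _ <= X]/(1%:C%C) ltcR lecR.
Qed.

Lemma B0_smooth f : B0 (f : Cplx R -> Cplx R) -> smooth0 f.
Proof.
move=> [hf bf]; apply: (@derivable_derive1n R f 1 1) => // z z1.
  by apply: hf; rewrite ltr_norm1.
by have := bf z; rewrite ltr_norm1 unit_normrE => /(_ z1) /andP[].
Qed.

Definition herglotz_factor (c : R) (zeta z : R[i]) : R[i] :=
  ((1 + c) / 2)%:C%C * (1 - zeta * z) / (1 - c%:C%C * zeta * z).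

Lemma herglotz_den (c : R) zeta z : 0 < c < 1 -> nm zeta = 1 -> nm z < 1 ->
  1 - c%:C%C * zeta * z != 0.
Proof.
move=> /andP[c0 c1] n1 z1; apply/eqP => /subr0_eq E.
have := nm1 R; rewrite E !nmM nm_real n1 mulr1 ger0_norm ?ltW// => F.
by have := nm_ge0 z; nra.
Qed.

Lemma nm_sqr_le (z w : R[i]) : complex.Re z ^+ 2 + complex.Im z ^+ 2 <=
  complex.Re w ^+ 2 + complex.Im w ^+ 2 -> nm z <= nm w.
Proof. by case: z w => [a b] [c d] /= H; rewrite /Normc.normc ler_wsqrtr. Qed.

Lemma sqr_nm (z : R[i]) : nm z ^+ 2 = complex.Re z ^+ 2 + complex.Im z ^+ 2.
Proof.
by case: z => a b; rewrite /Normc.normc sqr_sqrtr// addr_ge0// sqr_ge0.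
Qed.

(* The factor is 1 / (1 + e h) for the Herglotz kernel
   h = (1 + zeta z) / (1 - zeta z), Re h > 0, and e = (1 - c) / (1 + c). *)
Lemma herglotz_factor_le1 (c : R) zeta z : 0 < c < 1 -> nm zeta = 1 -> nm z < 1 ->
  0 < nm (herglotz_factor c zeta z) <= 1.
Proof.
move=> c01 n1 z1; have den := herglotz_den c01 n1 z1; case/andP: c01 => c0 c1.
have w1 : nm (zeta * z) < 1 by rewrite nmM n1 mul1r.
have num : 1 - zeta * z != 0.
  by apply/eqP => /subr0_eq E; have := nm1 R; rewrite E => F; rewrite F ltxx in w1.
apply/andP; split.
  rewrite lt_neqAle eq_sym nm_eq0 nm_ge0 andbT /herglotz_factor.
  rewrite !mulf_neq0 ?invr_neq0// eq_complex /= eqxx andbT.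
  by rewrite mulf_neq0 ?invr_eq0//; lra.
have dpos : 0 < nm (1 - c%:C%C * zeta * z) by rewrite lt_neqAle eq_sym nm_eq0 den nm_ge0.
rewrite /herglotz_factor nmM nmV ler_pdivrMr// mul1r.
apply: nm_sqr_le; rewrite -mulrA.
move: w1 => /ltW; rewrite -(ler_pXn2r (n := 2))// ?nnegrE ?nm_ge0// expr1n sqr_nm.
case: (zeta * z) => x y /=; rewrite !(mul0r, subr0, addr0, sub0r) => q1.
have x1 : -1 <= x by have := sqr_ge0 y; nra.
rewrite -subr_ge0.
(* With [zeta * z = x + i y], the gap between the squared moduli becomes a sum of terms that are
   nonnegative because [-1 <= x] and [x ^+ 2 + y ^+ 2 <= 1]. *)
have -> : (1 - c * x) ^+ 2 + (- (c * y)) ^+ 2 -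
  (((1 + c) / 2 * (1 - x)) ^+ 2 + ((1 + c) / 2 * (- y)) ^+ 2) =
  (1 - c) * (2 * (1 - c) * (1 + x) + (1 + 3 * c) * (1 - (x ^+ 2 + y ^+ 2))) / 4.
  by field.
rewrite divr_ge0// mulr_ge0//; first lra.
by rewrite addr_ge0// mulr_ge0//; [rewrite mulr_ge0//; lra | lra | lra | lra].
Qed.

Lemma B0_herglotz f (c : R) zeta : 0 < c < 1 -> nm zeta = 1 ->
  B0 (f : Cplx R -> Cplx R) ->
  B0 ((fun z => herglotz_factor c zeta z * f z) : Cplx R -> Cplx R).
Proof.
move=> c01 n1 [hf bf]; split=> z; rewrite ltr_norm1 => z1.
  apply: (@derivableM R[i] (R[i])^o); last by apply: hf; rewrite ltr_norm1.
  have lin (a b : R[i]) : derivable (fun z => a - b * z) z.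
    apply: derivableB; first exact: derivable_cst.
    by apply: derivableM; [exact: derivable_cst | exact: derivable_id].
  apply: (@derivableM R[i] (R[i])^o).
    apply: (@derivableM R[i] (R[i])^o); first exact: derivable_cst.
    exact: lin.
  apply: (@derivableV R[i] (R[i])^o); last exact: lin.
  exact: herglotz_den.
have := bf z; rewrite ltr_norm1 => /(_ z1).
have := herglotz_factor_le1 c01 n1 z1.
rewrite !unit_normrE => /andP[h0 h1] /andP[f0 f1].
by rewrite nmM mulr_gt0//= -[leRHS]mulr1 ler_pM// nm_ge0.
Qed.

(** Clearing the denominator gives [(1 - c zeta z) F = b (1 - zeta z) f] on the unit disc. Comparing
    coefficients yields a recursion in [k], and the sum on the right is its solution. *)
Lemma herglotz_tcoef f (c : R) zeta k : 0 < c < 1 -> nm zeta = 1 ->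
  B0 (f : Cplx R -> Cplx R) ->
  tcoef (fun z => herglotz_factor c zeta z * f z) k =
  ((1 + c) / 2)%:C%C * (tcoef f k +
    (c%:C%C - 1) * \sum_(j < k) c%:C%C ^+ j * zeta ^+ j.+1 * tcoef f (k - j.+1)).
Proof.
move=> c01 n1 Bf; pose F z := herglotz_factor c zeta z * f z.
have sF : smooth0 F by apply: B0_smooth; exact: B0_herglotz.
have sf := B0_smooth Bf.
set b := (_ / 2)%:C%C.
have FE z : nm z < 1 -> (1 - (c%:C%C * zeta) * z) * F z = (b - (b * zeta) * z) * f z.
  move=> z1; have den := herglotz_den c01 n1 z1.
  by rewrite /F /herglotz_factor -/b; field.
have E := tcoef_eq_ball ltr01 FE.
rewrite -/F; elim: k => [|k IH].
  by rewrite big_ord0 mulr0 addr0 -(tcoef_linear_factor0 (b * zeta)) -E tcoef_linear_factor0 mul1r.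
have := E k.+1; rewrite !tcoef_linear_factorS// mul1r => /eqP.
rewrite subr_eq => /eqP ->; rewrite IH big_ord_recl /= expr0 expr1 mul1r subSS subn0.
under [X in _ = _ * (_ + _ * (_ + X))]eq_bigr => j _.
  rewrite /bump /= add1n subSS.
  have -> : c%:C%C ^+ j.+1 * zeta ^+ j.+2 * tcoef f (k - j.+1) =
    (c%:C%C * zeta) * (c%:C%C ^+ j * zeta ^+ j.+1 * tcoef f (k - j.+1)).
    by rewrite !exprS; ring.
  over.
rewrite -mulr_sumr; move: (\sum_(j < k) _) (tcoef f k) (tcoef f k.+1) => S A B.
by ring.
Qed.

Lemma horner_lipschitz (p : {poly R[i]}) (a : R[i]) : nm a <= 1 ->
  exists2 K : R, 0 <= K & forall z, nm z <= 1 -> nm (p.[z] - p.[a]) <= K * nm (z - a).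
Proof.
move=> a1; elim/poly_ind: p => [|p c [K K0 H]].
  by exists 0 => // z _; rewrite !horner0 subrr nm0 mul0r.
exists (K + nm p.[a]); first by rewrite addr_ge0 ?nm_ge0.
move=> z z1; rewrite !hornerMXaddC.
have -> : p.[z] * z + c - (p.[a] * a + c) = (p.[z] - p.[a]) * z + p.[a] * (z - a) by ring.
apply: le_trans (nmD _ _) _; rewrite !nmM mulrDl lerD//.
apply: le_trans (ler_wpM2r (nm_ge0 _) (H z z1)) _.
by rewrite ler_piMr// mulr_ge0 ?nm_ge0.
Qed.

Lemma ReD (z w : R[i]) : complex.Re (z + w) = complex.Re z + complex.Re w.
Proof. by case: z w => [? ?] [? ?]. Qed.

Lemma ReN (z : R[i]) : complex.Re (- z) = - complex.Re z.
Proof. by case: z. Qed.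

Lemma ReZ (x : R) (z : R[i]) : complex.Re (x%:C%C * z) = x * complex.Re z.
Proof. by case: z => ? ? /=; rewrite mul0r subr0. Qed.

(** For [0 < c < 1], extremality against the product of [f] with [herglotz_factor c zeta] amounts to
    [0 <= (1 - c) * Re p(c)] for the polynomial [p] below. Dividing by [1 - c] and letting [c] tend
    to 1 gives the claim, since [p(1) = P(zeta)]. *)
Lemma Re_Ppoly_ge0 n f zeta : extremal n (f : Cplx R -> Cplx R) -> nm zeta = 1 ->
  0 <= complex.Re (Ppoly n (f : Cplx R -> Cplx R) zeta : R[i]).
Proof.
move=> [Bf ext] n1.
pose S (c : R[i]) : R[i] := \sum_(j < n) c ^+ j * zeta ^+ j.+1 * tcoef f (n - j.+1).
have Pq : (Ppoly n (f : Cplx R -> Cplx R) zeta : R[i]) = tcoef f n + 2 * S 1.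
  rewrite /Ppoly big_add1 /= big_mkord; congr (_ + 2 * _).
  by apply: eq_bigr => j _; rewrite expr1n mul1r mulrC.
pose p : {poly R[i]} := (tcoef f n)%:P + (1 + 'X) *
  \sum_(j < n) (zeta ^+ j.+1 * tcoef f (n - j.+1)) *: 'X^j.
have pE c : p.[c] = tcoef f n + (1 + c) * S c.
  rewrite /p !hornerE horner_sum /S; congr (_ + _ * _); apply: eq_bigr => j _.
  by rewrite hornerZ hornerXn mulrC mulrA.
have p1 : (Ppoly n (f : Cplx R -> Cplx R) zeta : R[i]) = p.[1].
  by rewrite Pq pE; congr (_ + _ * _); ring.
have pc (c : R) : 0 < c < 1 -> 0 <= complex.Re p.[c%:C%C].
  move=> c01; have := ext _ (B0_herglotz c01 n1 Bf).
  rewrite /Mn (herglotz_tcoef n c01 n1 Bf) -/(S _) pE.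
  have -> : (1 + c%:C%C) * S c%:C%C = (1 + c)%:C%C * S c%:C%C by rewrite rmorphD.
  have -> : c%:C%C - 1 = (c - 1)%:C%C :> R[i] by rewrite rmorphB.
  rewrite ReZ !ReD !ReZ; case/andP: c01 => c0 c1.
  move: (complex.Re (tcoef f n)) (complex.Re (S _)) => A B H.
  have : 0 <= (1 - c) * (A + (1 + c) * B) by lra.
  by rewrite pmulr_rge0// subr_gt0.
have [K K0 HK] := @horner_lipschitz p 1 ltac:(by rewrite nm1).
rewrite p1; apply/ler_addgt0Pr => /= e e0.
have K1 : 0 < K + 1 by lra.
(* At [c = 1 - d] the Lipschitz bound makes [p] differ from [p.[1]] by at most [K * d <= e]. *)
pose d := Num.min (1 / 2) (e / (K + 1)).
have [d0 dh de] : [/\ 0 < d, d <= 1 / 2 & d * (K + 1) <= e].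
  rewrite /d lt_min !divr_gt0// ge_min lexx; split => //.
  by rewrite -ler_pdivlMr// ge_min lexx orbT.
clearbody d; have c01 : 0 < 1 - d < 1 by lra.
have := pc _ c01; have := HK (1 - d)%:C%C.
have -> : (1 - d)%:C%C - 1 = (- d)%:C%C :> R[i] by rewrite rmorphB rmorph1 rmorphN addrAC subrr sub0r.
rewrite !nm_real normrN !ger0_norm; [|lra|lra].
have d1 : 1 - d <= 1 by lra.
move=> /(_ d1) hK h0; have := Re_le_nm (p.[(1 - d)%:C%C] - p.[1]).
rewrite ReD ReN ler_norml => /andP[_]; lra.
Qed.

End Variation.

(** * Double zeros of nonnegative trigonometric polynomials *)

Section FejerRiesz.
Variable R : realType.
Implicit Types (z w : R[i]) (S p : {poly R[i]}).
Local Notation nm := (@Normc.normc R).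

Lemma nm_cexp_i (t : R) : nm (cexp (0 +i* t)%C) = 1.
Proof. by rewrite nm_cexp expR0. Qed.

(* On the circle z^-n (z - w) S(z) is real and nonnegative, and at z = w e^(it) it
   equals i t w^(1-n) S(w) to first order in t; both signs of t force S(w) = 0. *)
Lemma circle_double_root S w n : nm w = 1 ->
  (forall z, nm z = 1 -> exists2 x : R, 0 <= x & (S * ('X - w%:P)).[z] = z ^+ n * x%:C%C) ->
  S.[w] = 0.
Proof.
move=> w1 HS.
have w0 : w != 0 by rewrite -nm_eq0 w1 oner_eq0.
(* The rotation takes [w] to 1: at [z = w * c] the hypothesis reads [(c - 1) * p.[c] = c ^+ n * x],
   and [p.[1]] is [S.[w]] up to a nonzero factor. *)
pose p := (w / w ^+ n) *: (S \Po (w *: 'X)).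
have [k kp] : {k | k = p.[1]} by exists p.[1].
have kE : k = w / w ^+ n * S.[w] by rewrite kp /p hornerZ horner_comp hornerZ hornerX mulr1.
suff k0 : k = 0.
  by apply/eqP; move/eqP: k0; rewrite kE mulf_eq0 mulf_eq0 invr_eq0 expf_eq0 (negPf w0) andbF.
have [K1 K10 H1] := @horner_lipschitz R p 1 ltac:(by rewrite nm1).
have [K2 K20 H2] := @horner_lipschitz R 'X^n 1 ltac:(by rewrite nm1).
have N0 := nm_ge0 k.
pose B := nm k + 2 * K1; pose L := K1 + K2 * B.
have B0 : 0 <= B by rewrite /B; lra.
have L0 : 0 <= L by rewrite /L addr_ge0// mulr_ge0.
(* Replacing [p.[c]] by [k] and [c ^+ n] by 1 costs only a second-order error, because [x] itself is
   at most [nm (c - 1) * B]. *)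
have circ c : nm c = 1 -> exists2 x : R, 0 <= x & nm ((c - 1) * k - x%:C%C) <= L * nm (c - 1) ^+ 2.
  move=> c1; have [x x0 E] := HS (w * c) ltac:(by rewrite nmM w1 c1 mulr1).
  exists x => //.
  have h1 := H1 c ltac:(by rewrite c1); have h2 := H2 c ltac:(by rewrite c1).
  rewrite !hornerXn expr1n -kp in h1 h2.
  have c2 : nm (c - 1) <= 2.
    by apply: le_trans (nmD _ _) _; rewrite nmN c1 nm1.
  have pE : (c - 1) * p.[c] = c ^+ n * x%:C%C.
    rewrite /p hornerZ horner_comp hornerZ hornerX.
    move: E; rewrite hornerM !hornerE exprMn => E.
    have wn0 : w ^+ n != 0 by rewrite expf_neq0.
    apply: (mulfI wn0); rewrite !mulrA -E.
    by field.
  have xB : x <= nm (c - 1) * B.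
    have -> : x = nm (c ^+ n * x%:C%C).
      rewrite nmM nm_real (ger0_norm x0).
      by rewrite nmX c1 expr1n mul1r.
    rewrite -pE nmM ler_wpM2l ?nm_ge0//.
    rewrite -[p.[c]](subrK k); apply: le_trans (nmD _ _) _.
    rewrite addrC /B lerD2l; apply: le_trans h1 _; rewrite mulrC; exact: ler_wpM2r.
  have -> : (c - 1) * k - x%:C%C = (c ^+ n - 1) * x%:C%C - (c - 1) * (p.[c] - k).
    by rewrite [(c ^+ n - 1) * _]mulrBl -pE; move: (p.[c]) => u; ring.
  apply: le_trans (nmD _ _) _; rewrite nmN !nmM nm_real (ger0_norm x0).
  have d0 := nm_ge0 (c - 1).
  have e1 := ler_wpM2l d0 h1.
  have e2 : nm (c ^+ n - 1) * x <= (K2 * nm (c - 1)) * (nm (c - 1) * B).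
    by apply: ler_pM => //; exact: nm_ge0.
  by rewrite /L; nra.
have small e : 0 < e -> exists2 r : R, 0 < r & forall t : R, `|t| < r ->
    exists2 x : R, 0 <= x & nm ('i%C * t%:C%C * k - x%:C%C) <= e * `|t|.
  move=> e0.
  (* The errors to absorb are [d * nm k] from the exponential and [4 * L * d] from [circ], both
     times [|t|]. *)
  have [d [d0 d1 d2]] : exists d : R, [/\ 0 < d, d <= 1 & d * (nm k + 4 * L) <= e].
    have D0 : 0 < nm k + 4 * L + 1 by lra.
    exists (Num.min 1 (e / (nm k + 4 * L + 1))).
    rewrite lt_min ltr01 divr_gt0// ge_min lexx; split => //.
    apply: (@le_trans _ _ (e / (nm k + 4 * L + 1) * (nm k + 4 * L + 1))); last by rewrite divfK// gt_eqF.
    by apply: ler_pM; rewrite ?ge_min ?lexx ?orbT//; [rewrite le_min ler01 divr_ge0 ?ltW | lra | lra].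
  have [r r0 Hr] := cdiff_cexp 0 d0.
  exists (Num.min r d); first by rewrite lt_min r0.
  move=> t; rewrite lt_min => /andP[tr td].
  have nt : nm ('i%C * t%:C%C) = `|t| by rewrite nmM nm_i nm_real mul1r.
  have := Hr ('i%C * t%:C%C); rewrite nt add0r cexp0 mul1r => /(_ tr).
  set c := cexp _ => hc.
  have c1 : nm c = 1.
    rewrite /c; have -> : 'i%C * t%:C%C = (0 +i* t)%C by simpc.
    exact: nm_cexp_i.
  have [x x0 hx] := circ c c1; exists x => //.
  have cle : nm (c - 1) <= 2 * `|t|.
    have -> : c - 1 = (c - 1 - 'i%C * t%:C%C) + 'i%C * t%:C%C by ring.
    apply: le_trans (nmD _ _) _; rewrite nt; have := ler_wpM2r (normr_ge0 t) d1; lra.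
  have -> : 'i%C * t%:C%C * k - x%:C%C = ((c - 1) * k - x%:C%C) - (c - 1 - 'i%C * t%:C%C) * k by ring.
  apply: le_trans (nmD _ _) _; rewrite nmN nmM.
  have m1 := ler_wpM2r N0 hc.
  have m2 : nm (c - 1) ^+ 2 <= 4 * d * `|t|.
    rewrite expr2; have -> : 4 * d * `|t| = (2 * d) * (2 * `|t|) by ring.
    apply: ler_pM; rewrite ?nm_ge0//; apply: le_trans cle _; lra.
  have m3 := ler_wpM2l L0 m2; have m4 := ler_wpM2r (normr_ge0 t) d2; lra.
have key e : 0 < e -> nm k <= e + e.
  move=> e0; have [r r0 Hr] := small e e0.
  have r2 : 0 < r / 2 by rewrite divr_gt0.
  have rr : r / 2 < r by rewrite ltr_pdivrMr// ltr_pMr// ltr1n.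
  have [x x0 hx] := Hr (r / 2) ltac:(by rewrite gtr0_norm).
  have [y y0 hy] := Hr (- (r / 2)) ltac:(by rewrite normrN gtr0_norm).
  rewrite normrN in hy; rewrite gtr0_norm// in hx hy.
  have a1 := le_trans (Re_le_nm _) hx; have a2 := le_trans (Im_le_nm _) hx.
  have b1 := le_trans (Re_le_nm _) hy.
  move: a1 a2 b1; move: (r / 2) r2 => q q0.
  (* With [k = u + i v], the imaginary part at [t = q] bounds [u]; the real parts at [t = q] and
     [t = - q], where [x] and [y] are nonnegative, bound [v] above and below. *)
  case: (k) => u v /=; rewrite !(mul0r, mul1r, mulr0, sub0r, subr0, addr0, add0r, oppr0, mulrN, mulNr, opprK).
  rewrite !ler_norml => /andP[a1 a2] /andP[a3 a4] /andP[a5 a6].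
  apply: le_trans (nm_le_ReIm _) _; rewrite /=; apply: lerD; rewrite ler_norml; apply/andP; split; nra.
apply/eqP; rewrite -nm_eq0 eq_le N0 andbT.
apply/ler_addgt0Pr => /= e e0; rewrite add0r [e]splitr; apply: key; exact: divr_gt0.
Qed.

End FejerRiesz.

(** * Elementary symmetric functions and the factorization of the trigonometric polynomial *)

Section Factorization.
Variable R : realType.
Local Notation C := (R[i]).
Local Notation nm := (@Normc.normc R).
Variables (n : nat) (zs : 'I_n -> C) (a : nat -> C).
Hypotheses (zs_inj : injective zs) (zs1 : forall j, nm (zs j) = 1).

Let mulJ (z : C) : nm z = 1 -> z * z^*%C = 1.
Proof. by move=> z1; rewrite -sqr_normc normrE z1 expr1n. Qed.

(* With P as in the theorem, on the circle this is z^n Re P(conj z); evaluating at conj z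
   instead of z makes a k, rather than its conjugate, the coefficient of 'X^k for k <= n. *)
Definition conj_trig_poly : {poly C} :=
  a n *: 'X^n + \sum_(k < n) (a k *: 'X^k + (a k)^*%C *: 'X^(2 * n - k)).

(** On the circle conj z is the inverse of z, so multiplication by [z ^+ n] turns the term [a k] of
    the sum into one of degree [k] and its conjugate into one of degree [2 * n - k]. Reality of
    [a n] merges the two middle terms. *)
Lemma horner_conj_trig_poly (z : C) : (a n)^*%C = a n -> nm z = 1 ->
  conj_trig_poly.[z] = z ^+ n *
    (complex.Re (a n + 2 * \sum_(j < n) a (n - j.+1)%N * z^*%C ^+ j.+1))%:C%C.
Proof.
move=> anJ z1; have zJ := mulJ z1.
have -> : \sum_(j < n) a (n - j.+1)%N * z^*%C ^+ j.+1 =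
    \sum_(k < n) a k * z^*%C ^+ (n - k).
  rewrite (reindex_inj rev_ord_inj); apply: eq_bigr => k _ /=.
  by rewrite subnSK// subKn// ltnW.
have zc m k : (k <= m)%N -> z ^+ m * z^*%C ^+ k = z ^+ (m - k).
  move=> km; rewrite -{1}(subnK km) exprD -mulrA -exprMn zJ expr1n mulr1 //.
rewrite /conj_trig_poly hornerD hornerZ hornerXn horner_sum.
have JE : (a n + 2 * (\sum_(k < n) a k * z^*%C ^+ (n - k)))^*%C =
    a n + 2 * (\sum_(k < n) (a k * z^*%C ^+ (n - k))^*%C).
  by rewrite [LHS]rmorphD rmorphM rmorph_nat rmorph_sum /= anJ.
rewrite ReJ_add JE.
have -> : z ^+ n * ((a n + 2 * (\sum_(k < n) a k * z^*%C ^+ (n - k)) +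
    (a n + 2 * (\sum_(k < n) (a k * z^*%C ^+ (n - k))^*%C))) / 2) =
  a n * z ^+ n + (z ^+ n * (\sum_(k < n) a k * z^*%C ^+ (n - k)) +
    z ^+ n * (\sum_(k < n) (a k * z^*%C ^+ (n - k))^*%C)).
  move: (\sum_(k < n) _) (\sum_(k < n) _) => A B; by field.
congr (_ + _); rewrite !mulr_sumr -big_split; apply: eq_bigr => k _ /=.
rewrite hornerD !hornerZ !hornerXn rmorphM rmorphXn /= conjcK; congr (_ + _).
  by rewrite mulrCA zc ?leq_subr// subKn// ltnW.
by rewrite mulrCA -exprD; congr (_ * _ ^+ _); rewrite mul2n -addnn addnBA// ltnW.
Qed.

(** Expand the product over the set [I] of factors that contribute their linear term. *)
Lemma coef_prod_one_sub k :
  (\prod_(j < n) (1 - zs j *: 'X) : {poly C})`_k = (-1) ^+ k * (elem_sym k zs : C).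
Proof.
have -> : \prod_(j < n) (1 - zs j *: 'X) =
    \sum_(I : {set 'I_n}) (\prod_(i in I) - zs i) *: 'X^#|I| :> {poly C}.
  under eq_bigr do rewrite addrC -scaleNr.
  rewrite bigA_distr /=; apply: eq_bigr => I _.
  rewrite -big_mkcond /= (eq_bigr (fun i => (- zs i)%:P * 'X)).
    by rewrite big_split /= prodr_const -mul_polyC rmorph_prod.
  by move=> i _; rewrite mul_polyC.
rewrite coef_sum /elem_sym mulr_sumr [RHS]big_mkcond /=; apply: eq_bigr => I _.
rewrite coefZ coefXn eq_sym; case: eqP => [<-|_]; last by rewrite mulr0.
by rewrite mulr1 prodrN.
Qed.

(** Pass to complements of index sets: the product over the complement of [I] is the full product
    divided by the one over [I], and dividing by a unimodular number is multiplying by its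
    conjugate. *)
Lemma elem_symC k : (k <= n)%N ->
  (elem_sym (n - k) zs : C) = (\prod_(j < n) zs j) * (elem_sym k zs : C)^*%C.
Proof.
move=> kn; rewrite /elem_sym rmorph_sum mulr_sumr.
rewrite (reindex_inj (@finset.setC_inj _)) /=; apply: eq_big => [I|I _].
  rewrite cardsCs finset.setCK card_ord; have := max_card (mem I); rewrite card_ord => cI.
  by apply/eqP/eqP => [|->//] E; rewrite -(subKn cI) E subKn.
rewrite [\prod_(j < n) zs j](bigID (fun i => i \in I)) /= rmorph_prod mulrAC -big_split /=.
rewrite [X in _ = X * _]big1 ?mul1r => [|i iI]; last exact: mulJ.
by apply: eq_bigl => i; rewrite inE.
Qed.

Definition trig_re (z : C) : R :=
  complex.Re (a n + 2 * \sum_(j < n) a (n - j.+1)%N * z ^+ j.+1).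

Hypotheses (n_gt0 : (0 < n)%N) (anJ : (a n)^*%C = a n)
  (trig_ge0 : forall z, nm z = 1 -> 0 <= trig_re z)
  (trig_zs : forall j, trig_re (zs j) = 0).

(** The roots are the conjugates of the [zs j]. Their product [Pi] divides once because they are
    roots and again by [circle_double_root]; the degree bound [2 * n] leaves a constant cofactor,
    determined by the value at 0. *)
Lemma conj_trig_polyE : conj_trig_poly = a 0%N *: (\prod_(j < n) (1 - zs j *: 'X)) ^+ 2.
Proof.
pose rs := [seq (zs j)^*%C | j <- enum 'I_n].
pose Pi : {poly C} := \prod_(z <- rs) ('X - z%:P).
have nmJ (z : C) : nm z^*%C = nm z.
  by apply: complexI; rewrite -!normrE normcJ.
have rs1 z : z \in rs -> nm z = 1.
  by case/mapP => j _ ->; rewrite nmJ.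
have urs : uniq rs.
  by rewrite map_inj_uniq ?enum_uniq// => i j /(can_inj (@conjcK R)) /zs_inj.
have Qcirc z : nm z = 1 -> exists2 x : R, 0 <= x & conj_trig_poly.[z] = z ^+ n * x%:C%C.
  move=> z1; exists (trig_re z^*%C); first by apply: trig_ge0; rewrite nmJ.
  exact: horner_conj_trig_poly.
have Qrs : all (root conj_trig_poly) rs.
  apply/allP => z /[dup] /rs1 z1 /mapP[j _ zE].
  rewrite /root horner_conj_trig_poly// zE conjcK -/(trig_re (zs j)) trig_zs.
  by rewrite rmorph0 mulr0.
have [S QS] := uniq_roots_prod_XsubC Qrs ltac:(by rewrite uniq_rootsE).
have Srs : all (root S) rs.
  apply/allP => z zrs; have := rs1 _ zrs => z1.
  have PE : Pi = (\prod_(y <- rem z rs) ('X - y%:P)) * ('X - z%:P).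
    by rewrite /Pi (big_rem z)//= mulrC.
  rewrite -/Pi PE mulrA in QS.
  (* Only one factor at [z] is split off; the remaining ones do not vanish at [z] since the roots
     are distinct, so the zero falls on [S]. *)
  have := circle_double_root z1 (n := n) (S := S * \prod_(y <- rem z rs) ('X - y%:P)).
  rewrite -QS => /(_ Qcirc) /eqP; rewrite hornerM mulf_eq0 => /orP[//|].
  by rewrite -/(root _ _) root_prod_XsubC mem_rem_uniq// inE eqxx.
have [T ST] := uniq_roots_prod_XsubC Srs ltac:(by rewrite uniq_rootsE).
have mPi : Pi \is monic by exact: monic_prod_XsubC.
have sPi : size Pi = n.+1 by rewrite size_prod_XsubC size_map size_enum_ord.
rewrite ST -/Pi in QS.
have sQ : (size conj_trig_poly <= (2 * n).+1)%N.
  rewrite /conj_trig_poly (leq_trans (size_polyD _ _))// geq_max; apply/andP; split.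
    by rewrite (leq_trans (size_scale_leq _ _))// size_polyXn ltnS mul2n -addnn leq_addr.
  apply: (leq_trans (size_sum _ _ _)); apply/bigmax_leqP => k _.
  rewrite (leq_trans (size_polyD _ _))// geq_max; apply/andP; split.
    rewrite (leq_trans (size_scale_leq _ _))// size_polyXn ltnS mul2n -addnn.
    by rewrite (leq_trans (ltnW (ltn_ord k)))// leq_addr.
  by rewrite (leq_trans (size_scale_leq _ _))// size_polyXn ltnS leq_subr.
have sT : (size T <= 1)%N.
  have [->|T0] := eqVneq T 0; first by rewrite size_poly0.
  have TP0 : T * Pi != 0 by rewrite mulf_neq0// monic_neq0.
  move: sQ; rewrite QS size_Mmonic// size_Mmonic// sPi.
  by rewrite !addnS /= mul2n -addnn -addnA -add1n leq_add2r.
have [t Tt] : exists t, T = t%:P by exists T`_0; exact: size1_polyC.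
(* As conj (zs j) is the inverse of [zs j], each [1 - zs j *: 'X] is [- zs j] times the monic factor
   at conj (zs j). *)
pose m := \prod_(j < n) (- zs j).
have VE : \prod_(j < n) (1 - zs j *: 'X) = m *: Pi :> {poly C}.
  rewrite /Pi big_map big_enum /m -scaler_prod; apply: eq_bigr => j _.
  by rewrite scalerBr !scaleNr opprK scale_polyC mulJ// polyC1 addrC.
have m0 : m != 0.
  rewrite prodf_seq_neq0; apply/allP => j _ /=.
  by rewrite oppr_eq0 -nm_eq0 zs1 oner_eq0.
have QV : conj_trig_poly = (t / m ^+ 2) *: (\prod_(j < n) (1 - zs j *: 'X)) ^+ 2.
  rewrite VE exprZn scalerA divfK ?expf_neq0// QS Tt mul_polyC expr2 scalerAl.
  by [].
rewrite QV; congr (_ *: _).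
have := congr1 (fun p : {poly C} => p.[0]) QV.
have -> : conj_trig_poly.[0] = a 0%N.
  rewrite /conj_trig_poly hornerD hornerZ hornerXn expr0n eqn0Ngt n_gt0 mulr0 add0r.
  rewrite horner_sum (bigD1 (Ordinal n_gt0))//= big1 => [|k k0].
    rewrite addr0 hornerD !hornerZ !hornerXn expr0 mulr1 subn0 expr0n muln_eq0 /=.
    by rewrite eqn0Ngt n_gt0 mulr0 addr0.
  rewrite hornerD !hornerZ !hornerXn !expr0n.
  have -> : (k == 0 :> nat) = false by apply/negbTE.
  rewrite subn_eq0 leqNgt (leq_trans (ltn_ord k)) ?mul2n -?addnn ?leq_addr//=.
  by rewrite !mulr0 addr0.
rewrite hornerZ horner_exp horner_prod big1 ?expr1n ?mulr1// => j _.
by rewrite !hornerE ?mulr0 ?subr0.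
Qed.

End Factorization.

(** * Reading off the coefficients of the extremal function *)

Unset Implicit Arguments.

Theorem theorem5 (R : realType) (n : nat) (f : Cplx R -> Cplx R)
  (zs : 'I_n -> Cplx R) :
  (0 < n)%N ->
  extremal n f ->
  0 < tcoef f 0 -> 0 < tcoef f n ->
  injective zs ->
  (forall j, `|zs j| = 1) ->
  (forall j, complex.Re (Ppoly n f (zs j) : R[i]) = 0) ->
  [/\ (forall k : nat, (k <= n)%N ->
        tcoef f k =
        (tcoef f 0 *: \prod_(j < n) ((1 - zs j *: 'X) ^+ 2 : {poly Cplx R}))`_k),
      \prod_(j < n) zs j = (-1) ^+ n
    & tcoef f n =
      tcoef f 0 * (2 + \sum_(1 <= k < n) `|elem_sym k zs| ^+ 2)].
Proof.
move=> n0 fext a0_gt0 an_gt0 zs_inj zs1 Pzs.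
pose a k : R[i] := tcoef f k.
have nmzs j : Normc.normc (zs j : R[i]) = 1.
  by have := zs1 j; rewrite normrE => /(congr1 (@complex.Re R)).
(* Positivity in [R[i]] includes a vanishing imaginary part. *)
have aJ k : 0 < a k -> (a k)^*%C = a k.
  by rewrite ltcE /=; case: (a k) => x y /= /andP[/eqP -> _]; rewrite oppr0.
have trigE z : trig_re n a z = complex.Re (Ppoly n f z : R[i]).
  rewrite /trig_re /Ppoly big_add1 /= big_mkord; congr (complex.Re _).
have tge0 z : Normc.normc z = 1 -> 0 <= trig_re n a z.
  by move=> z1; rewrite trigE; exact: Re_Ppoly_ge0.
have tzs j : trig_re n a (zs j) = 0 by rewrite trigE Pzs.
have QE := conj_trig_polyE zs_inj nmzs n0 (aJ n an_gt0) tge0 tzs.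
have coefQ k : (k <= n)%N -> (conj_trig_poly n a)`_k = a k.
  move=> kn; rewrite /conj_trig_poly coefD coefZ coefXn coef_sum.
  (* The mirrored exponents [2 * n - i] with [i < n] exceed [n], so they do not touch the
     coefficients up to [n]. *)
  have far (i : 'I_n) : (k == 2 * n - i)%N = false.
    apply/negbTE; rewrite neq_ltn; apply/orP; left; apply: leq_ltn_trans kn _.
    have i0 : (0 < n - i)%N by rewrite subn_gt0.
    by rewrite mul2n -addnn -addnBA ?(ltnW (ltn_ord i))// -[ltnLHS]addn0 ltn_add2l.
  have [kE|kn'] := eqVneq k n.
    subst k; rewrite mulr1 big1 ?addr0// => i _.
    by rewrite coefD !coefZ !coefXn (far i) (gtn_eqF (ltn_ord i)) !mulr0 addr0.
  have ltkn : (k < n)%N by rewrite ltn_neqAle kn'.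
  rewrite mulr0 add0r (bigD1 (Ordinal ltkn))//= big1 => [|i ik].
    by rewrite addr0 coefD !coefZ !coefXn eqxx (far (Ordinal ltkn)) mulr1 mulr0 addr0.
  rewrite coefD !coefZ !coefXn (far i).
  have -> : (k == i)%N = false by apply/negbTE; rewrite eq_sym.
  by rewrite !mulr0 addr0.
pose V : {poly R[i]} := \prod_(j < n) (1 - zs j *: 'X).
have aV k : (k <= n)%N -> a k = (a 0%N *: V ^+ 2)`_k by move=> kn; rewrite -QE coefQ.
pose E k : R[i] := elem_sym k zs.
pose en : R[i] := \prod_(j < n) zs j.
have coefV k : V`_k = (-1) ^+ k * E k by exact: coef_prod_one_sub.
have EC k : (k <= n)%N -> E (n - k)%N = en * (E k)^*%C by exact: elem_symC.
have E0 : E 0%N = 1.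
  rewrite /E /elem_sym (big_pred1 finset.set0) => [|I]; first by rewrite big_set0.
  by rewrite cards_eq0.
have En : E n = en by have := EC 0%N (leq0n n); rewrite subn0 E0 conjc1 mulr1.
have nmen : Normc.normc en = 1.
  rewrite /en; elim/big_rec: _ => [|j x _ x1]; first exact: nm1.
  by rewrite nmM nmzs x1 mulr1.
(* In the Cauchy product for [V ^+ 2] the signs combine to [(-1) ^+ n], and [EC] turns
   [E k * E (n - k)] into [en * |E k| ^+ 2]. *)
have anE : a n = a 0%N * ((-1) ^+ n * en * \sum_(k < n.+1) `|E k| ^+ 2).
  rewrite aV// coefZ expr2 coefM; congr (_ * _); rewrite mulr_sumr.
  apply: eq_bigr => k _; have kn : (k <= n)%N by rewrite -ltnS.
  rewrite !coefV EC// sqr_normc.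
  have -> : (-1) ^+ n = (-1) ^+ k * (-1) ^+ (n - k) :> R[i] by rewrite -exprD subnKC.
  by move: ((-1) ^+ k) ((-1) ^+ (n - k)) (E k) => x y z; ring.
pose s := \sum_(k < n.+1) `|E k| ^+ 2.
have s_gt0 : 0 < s.
  rewrite /s big_ord_recl E0 normr1 expr1n; apply: ltr_pwDl; first exact: ltr01.
  by apply: sumr_ge0 => k _; exact: exprn_ge0.
pose u := (-1) ^+ n * en.
(* [a n], [a 0] and [s] are positive, so [u] is a positive real; its modulus is 1. *)
have u1 : u = 1.
  have u_gt0 : 0 < u.
    rewrite -(pmulr_lgt0 _ s_gt0) -(pmulr_rgt0 _ a0_gt0).
    by have := an_gt0; rewrite -[tcoef f n]/(a n) anE.
  by rewrite -(gtr0_norm u_gt0) normrM normrX normrN1 expr1n mul1r normrE nmen.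
split.
- by move=> k kn; rewrite prodrXl; exact: aV.
- have : (-1) ^+ n * u = (-1) ^+ n by rewrite u1 mulr1.
  by rewrite /u mulrA -expr2 sqrr_sign mul1r.
rewrite -[LHS]/(a n) anE -/u u1 mul1r; congr (_ * _).
(* The terms [k = 0] and [k = n] both equal 1 and make up the 2. *)
rewrite -(big_mkord xpredT (fun k => `|E k| ^+ 2)) big_ltn// big_nat_recr//=.
by rewrite En E0 normr1 expr1n [`|en|]normrE nmen expr1n addrC -addrA addrC.
Qed.
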